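(* Let $\mathcal M$ be a $W^*$-algebra, $\alpha\colon\mathcal M\to\mathcal M$ a weak$^*$-continuous, completely positive, completely contractive linear mapping, and denote $\mathcal M^\alpha=\{x\in\mathcal M\mid\alpha(x)=x\}$. Then there exists an idempotent, completely positive, completely contractive linear mapping $P\colon\mathcal M\to\mathcal M$ with $\operatorname{Ran}P=\mathcal M^\alpha$. *)

(* Defs.v *)
From HB Require Import structures.
From mathcomp Require Import all_boot all_order all_algebra.
From mathcomp Require Import complex.
From mathcomp Require Import all_classical all_reals all_analysis.

Set Implicit Arguments.
Unset Strict Implicit.
Unset Printing Implicit Defensive.

Import Order.TTheory GRing.Theory Num.Theory.
Import numFieldNormedType.Exports.

Local Open Scope classical_set_scope.
Local Open Scope ring_scope.
Local Open Scope complex_scope.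

(* Unital complex C*-algebras: Banach *-algebras over R[i] with the
   C*-identity.  The ring operations are part of the mixin, and the ring
   structure is derived below, because Hierarchy Builder does not accept a new
   common descendant of its rings and its normed modules.  Neither 1 != 0 nor
   `|1| = 1 is required: the zero algebra is a C*-algebra, and the C*-identity
   gives `|1| = 1 in all others. *)
HB.mixin Record isCStarAlgebra (R : realType) A
    of CompleteNormedModule R[i] A := {
  cunit : A ;
  cmul : A -> A -> A ;
  star : A -> A ;
  cmulA : associative cmul ;
  cmul1l : left_id cunit cmul ;
  cmul1r : right_id cunit cmul ;
  cmulDl : left_distributive cmul +%R ;
  cmulDr : right_distributive cmul +%R ;
  cmulZl : forall (a : R[i]) (x y : A), cmul (a *: x) y = a *: cmul x y ;
  cmulZr : forall (a : R[i]) (x y : A), cmul x (a *: y) = a *: cmul x y ;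
  starK : involutive star ;
  starD : forall x y : A, star (x + y) = star x + star y ;
  starZ : forall (a : R[i]) (x : A), star (a *: x) = Num.conj a *: star x ;
  starM : forall x y : A, star (cmul x y) = cmul (star y) (star x) ;
  cnormM : forall x y : A, `|cmul x y| <= `|x| * `|y| ;
  cstar_identity : forall x : A, `|cmul (star x) x| = `|x| ^+ 2 }.

#[short(type="cstarAlgType")]
HB.structure Definition CStarAlgebra (R : realType) :=
  {A of CompleteNormedModule R[i] A & isCStarAlgebra R A}.

HB.instance Definition _ (R : realType) (A : cstarAlgType R) :=
  GRing.Zmodule_isPzRing.Build (CStarAlgebra.sort A)
    (@cmulA R A) (@cmul1l R A) (@cmul1r R A) (@cmulDl R A) (@cmulDr R A).

(* Norms of normed spaces over R[i] take their values in R[i] (in its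
   nonnegative real elements); rnorm is the same norm, valued in R. *)
Definition rnorm (R : realType) (V : normedModType R[i]) (x : V) : R :=
  complex.Re `|x|.

Definition opnorm (R : realType) (V W : normedModType R[i]) (f : V -> W) : R :=
  sup [set rnorm (f x) | x in [set x : V | rnorm x <= 1]].

(* A predual of A: a Banach space X with an isometric linear isomorphism of A
   onto the dual of X.  A W*-algebra is a C*-algebra A together with some
   D : predual A. *)
Record predual (R : realType) (A : cstarAlgType R) := Predual {
  predual_space : completeNormedModType R[i] ;
  predual_pair : A -> {linear predual_space -> R[i]^o} ;
  predual_pair_continuous : forall a, continuous (predual_pair a) ;
  predual_pair_linear : forall (c : R[i]) (a b : A) (x : predual_space),
    predual_pair (c *: a + b) x = c * predual_pair a x + predual_pair b x ;
  predual_pair_isometry : forall a, opnorm (predual_pair a) = rnorm a ;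
  predual_pair_onto : forall f : {linear predual_space -> R[i]^o},
    continuous f -> exists a, forall x, predual_pair a x = f x }.

(* A with the weak* topology sigma(A, X) *)
Definition weakstar (R : realType) (A : cstarAlgType R) (D : predual A) :
    topologicalType :=
  initial_topology
    (fun a : A => (predual_pair D a : {ptws predual_space D -> R[i]^o})).

Definition weakstar_continuous (R : realType) (A : cstarAlgType R)
    (D : predual A) (f : A -> A) : Prop :=
  continuous (f : weakstar D -> weakstar D).

Section Matrices.
Variables (R : realType) (A : cstarAlgType R).

Definition adjmx m n (X : 'M[A]_(m, n)) : 'M[A]_(n, m) :=
  map_mx (@star R A) X^T.

(* positivity in the *-algebra M_n(A) *)
Definition mx_ge0 n (X : 'M[A]_n) : Prop :=
  exists Y : 'M[A]_n, X = adjmx Y *m Y.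

(* norm of the Hilbert A-module A^n, whose A-valued inner product is
   <v, w> = \sum_i v_i^* w_i *)
Definition hilb_norm n (v : 'cV[A]_n) : R :=
  Num.sqrt (rnorm ((adjmx v *m v) 0 0)).

(* C*-norm of M_n(A), as the operator norm of its action on A^n; this is not
   the library's norm on matrices, which is the maximum of the norms of the
   entries. *)
Definition cstar_mxnorm n (X : 'M[A]_n) : R :=
  sup [set hilb_norm (X *m v) | v in [set v : 'cV[A]_n | hilb_norm v <= 1]].

Definition completely_positive (f : A -> A) : Prop :=
  forall n (X : 'M[A]_n), mx_ge0 X -> mx_ge0 (map_mx f X).

Definition completely_contractive (f : A -> A) : Prop :=
  forall n (X : 'M[A]_n), cstar_mxnorm (map_mx f X) <= cstar_mxnorm X.

Definition fixed_points (f : A -> A) : set A := [set x | f x = x].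

End Matrices.

(* Main.v *)
Require Import Defs.
From HB Require Import structures.
From mathcomp Require Import all_boot all_order all_algebra.
From mathcomp Require Import complex.
From mathcomp Require Import all_classical all_reals all_analysis.
From mathcomp Require Import zify ring lra.
From mathcomp Require cyclic separable cyclotomic.

(* P x is the weak* limit, along a free ultrafilter, of the Cesaro means of the
   iterates of alpha at x.  Weak*-continuity of alpha makes alpha (P x) = P x,
   and P fixes the fixed points of alpha.

   That P is again completely contractive and completely positive rests on the
   identities lim (b x_n) = b lim x_n and lim (x_n b) = (lim x_n) b.  Since the
   limit is a contraction that is the identity on constant sequences, this is
   Tomiyama's theorem on conditional expectations; its usual proof by spectral
   projections is replaced by an argument with cosines of a unitary w.  If
   lim (star w y_n) = 0, v = lim (w y_n), and C is the real part of
   conj zeta w with |zeta| = 1, contractivity forces |C^(2m) v|^2 = O(1/m);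
   the sum of C^(4m) over the (4m+1)-th roots of unity zeta being a scalar of
   order sqrt m, v must vanish.

   Order in a C*-algebra is handled through squares of selfadjoint elements,
   without spectral theory.  A matrix X all of whose values star v X v are
   positive is written as star Y Y by a Cholesky factorization, whose
   off-diagonal entries are again weak* limits. *)

Set Implicit Arguments.
Unset Strict Implicit.
Unset Printing Implicit Defensive.

Import Order.TTheory GRing.Theory Num.Theory.
Import numFieldNormedType.Exports.

Local Open Scope classical_set_scope.
Local Open Scope ring_scope.
Local Open Scope complex_scope.

(** A [predual] is only a Banach space with an isometric duality: nothing ties its topology to the
    product or the involution of [A]. Yet the norm of a matrix [X] and its positivity are tested on
    [dot w (X *m v)], where entries of [X] are multiplied by elements of [A], so limits of products
    cannot be avoided. What passes to a weak* limit at the outset is linear combinations and upper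
    bounds on the norm. Hence the facts needed are recast as norm inequalities: positivity of a
    selfadjoint x as |t - x| <= t, selfadjointness through the growth of |1 + i s x| in the real
    number s. The rate O(1/m) is essential: the sum over the roots of unity has mean of order 1/sqrt
    m, so the argument gives |v|^2 = O(1/sqrt m); terms of order 1/sqrt m would give nothing.
    Complete positivity asks for a factor [Y] with entries in [A]. Since M_n(A) is not made into a
    C*-algebra here, the square roots built in [A] do not apply to matrices, whence a factorization
    entry by entry. *)

(** * Identities in noncommutative algebras, by reflection *)

Section NonCommutative.
Variables (R : realType) (A : cstarAlgType R).
Implicit Types (x y : A) (a : R[i]).

Lemma scaleAl a x y : (a *: x) * y = a *: (x * y).
Proof. exact: cmulZl. Qed.

Lemma scaleAr a x y : x * (a *: y) = a *: (x * y).
Proof. exact: cmulZr. Qed.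

Inductive nc_expr :=
  | NCvar of nat | NC0 | NC1 | NCadd of nc_expr & nc_expr | NCopp of nc_expr
  | NCmul of nc_expr & nc_expr | NCscale of R[i] & nc_expr
  | NCmuln of nc_expr & nat.

Variable env : seq A.

Fixpoint nc_eval (e : nc_expr) : A :=
  match e with
  | NCvar i => nth 0 env i
  | NC0 => 0
  | NC1 => 1
  | NCadd e f => nc_eval e + nc_eval f
  | NCopp e => - nc_eval e
  | NCmul e f => nc_eval e * nc_eval f
  | NCscale a e => a *: nc_eval e
  | NCmuln e n => nc_eval e *+ n
  end.

Fixpoint word_eqb (u v : seq nat) : bool :=
  match u, v with
  | [::], [::] => true
  | i :: u, j :: v => if Nat.eqb i j then word_eqb u v else false
  | _, _ => false
  end.

Definition nc_poly := seq (R[i] * seq nat).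

Definition word_eval (u : seq nat) : A := foldr (fun i x => nth 0 env i * x) 1 u.
Definition poly_eval (p : nc_poly) : A :=
  foldr (fun m x => m.1 *: word_eval m.2 + x) 0 p.

Definition nc_mulm (m : R[i] * seq nat) (p : nc_poly) : nc_poly :=
  map (fun m' => (m.1 * m'.1, m.2 ++ m'.2)) p.

Fixpoint nc_norm (e : nc_expr) : nc_poly :=
  match e with
  | NCvar i => [:: (1, [:: i])]
  | NC0 => [::]
  | NC1 => [:: (1, [::])]
  | NCadd e f => nc_norm e ++ nc_norm f
  | NCopp e => map (fun m => (- m.1, m.2)) (nc_norm e)
  | NCmul e f =>
      foldr (fun m p => nc_mulm m (nc_norm f) ++ p) [::] (nc_norm e)
  | NCscale a e => map (fun m => (a * m.1, m.2)) (nc_norm e)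
  | NCmuln e n => map (fun m => (m.1 *+ n, m.2)) (nc_norm e)
  end.

Fixpoint nc_insert (a : R[i]) (u : seq nat) (p : nc_poly) : nc_poly :=
  match p with
  | [::] => [:: (a, u)]
  | (b, v) :: p =>
      if word_eqb u v then (a + b, v) :: p else (b, v) :: nc_insert a u p
  end.

Definition nc_collect (p : nc_poly) : nc_poly :=
  foldr (fun m q => nc_insert m.1 m.2 q) [::] p.

(** A conjunction of propositions and not a Boolean test: equality in [R[i]] is not settled by
    computation, so each coefficient is left as a goal for [field] or [ring]. *)
Fixpoint nc_zero (p : nc_poly) : Prop :=
  match p with
  | [::] => True
  | (a, _) :: p => a = 0 /\ nc_zero p
  end.

Lemma word_eqbP u v : word_eqb u v -> u = v.
Proof.
elim: u v => [|i u IH] [|j v] //=.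
by case: (PeanoNat.Nat.eqb_spec i j) => // -> /IH ->.
Qed.

Lemma poly_eval_cat p q : poly_eval (p ++ q) = poly_eval p + poly_eval q.
Proof. by elim: p => [|m p IH] /=; rewrite ?add0r // IH addrA. Qed.

Lemma word_eval_cat u v : word_eval (u ++ v) = word_eval u * word_eval v.
Proof. by elim: u => [|i u IH] /=; rewrite ?mul1r // IH mulrA. Qed.

Lemma poly_eval_mulm m p :
  poly_eval (nc_mulm m p) = (m.1 *: word_eval m.2) * poly_eval p.
Proof.
elim: p => [|m' p IH] /=; first by rewrite mulr0.
rewrite IH mulrDr word_eval_cat; congr (_ + _).
by rewrite scaleAr scaleAl scalerA [_ * m.1]mulrC.
Qed.

Lemma nc_normE e : poly_eval (nc_norm e) = nc_eval e.
Proof.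
elim: e => [i|||e He f Hf|e He|e He f Hf|a e He|e He n] /=; rewrite -?He -?Hf //.
- by rewrite scale1r addr0 mulr1.
- by rewrite scale1r addr0.
- by rewrite poly_eval_cat.
- by elim: (nc_norm e) => [|m p IH] /=; rewrite ?oppr0 // IH opprD scaleNr.
- elim: (nc_norm e) => [|m p IH] /=; first by rewrite mul0r.
  by rewrite poly_eval_cat IH mulrDl poly_eval_mulm.
- elim: (nc_norm e) => [|m p IH] /=; first by rewrite scaler0.
  by rewrite IH scalerDr scalerA.
- elim: (nc_norm e) => [|m p IH] /=; first by rewrite mul0rn.
  by rewrite IH mulrnDl scalerMnl.
Qed.

Lemma poly_eval_insert a u p :
  poly_eval (nc_insert a u p) = a *: word_eval u + poly_eval p.
Proof.
elim: p => [|[b v] p IH] //=.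
case E: (word_eqb u v) => /=; last by rewrite IH addrCA.
by rewrite (word_eqbP E) scalerDl addrA.
Qed.

Lemma poly_eval_collect p : poly_eval (nc_collect p) = poly_eval p.
Proof. by elim: p => [|m p IH] //=; rewrite poly_eval_insert IH. Qed.

Lemma nc_correct e f :
  nc_zero (nc_collect (nc_norm (NCadd e (NCopp f)))) -> nc_eval e = nc_eval f.
Proof.
move=> H; apply/subr0_eq; rewrite -[LHS]/(nc_eval (NCadd e (NCopp f))).
rewrite -nc_normE -poly_eval_collect.
by elim: (nc_collect _) H => [|[a u] p IH] //= [-> /IH ->]; rewrite scale0r addr0.
Qed.

End NonCommutative.

Ltac nc_index x env :=
  lazymatch env with
  | x :: _ => constr:(0%N)
  | _ :: ?e => let i := nc_index x e in constr:(S i)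
  end.

Ltac nc_mem x env :=
  lazymatch env with
  | nil => constr:(false)
  | x :: _ => constr:(true)
  | _ :: ?e => nc_mem x e
  end.

Ltac nc_vars t env :=
  lazymatch t with
  | @GRing.zero _ => env
  | @GRing.one _ => env
  | @GRing.add _ ?x ?y => let env := nc_vars x env in nc_vars y env
  | @GRing.opp _ ?x => nc_vars x env
  | @GRing.mul _ ?x ?y => let env := nc_vars x env in nc_vars y env
  | @GRing.scale _ _ _ ?x => nc_vars x env
  | @GRing.natmul _ ?x _ => nc_vars x env
  | _ => lazymatch nc_mem t env with true => env | false => constr:(t :: env) end
  end.

Ltac nc_reify R t env :=
  lazymatch t with
  | @GRing.zero _ => constr:(@NC0 R)
  | @GRing.one _ => constr:(@NC1 R)
  | @GRing.add _ ?x ?y =>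
      let e := nc_reify R x env in let f := nc_reify R y env in
      constr:(NCadd e f)
  | @GRing.opp _ ?x => let e := nc_reify R x env in constr:(NCopp e)
  | @GRing.mul _ ?x ?y =>
      let e := nc_reify R x env in let f := nc_reify R y env in
      constr:(NCmul e f)
  | @GRing.scale _ _ ?a ?x =>
      let e := nc_reify R x env in constr:(@NCscale R a e)
  | @GRing.natmul _ ?x ?n => let e := nc_reify R x env in constr:(NCmuln e n)
  | _ => let i := nc_index t env in constr:(@NCvar R i)
  end.

(* Reduces an identity in the free algebra over R[i] on the atoms of the goal
   to identities between coefficients. *)
Ltac nc_simpl A R :=
  rewrite ?(expr2, exprS, expr0);
  lazymatch goal with
  | |- @eq ?T ?x ?y =>
    let env := nc_vars x (@nil T) in
    let env := nc_vars y env in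
    let e := nc_reify R x env in
    let f := nc_reify R y env in
    refine (@nc_correct R A env e f _);
    cbv [nc_collect nc_norm nc_insert nc_zero nc_mulm word_eqb map foldr cat
         fst snd Nat.eqb]
  end.

Ltac ncring_in A R := nc_simpl A R; repeat split; try by [field | ring].

Ltac ncring :=
  lazymatch goal with
  | A : cstarAlgType ?R |- _ => ncring_in A R
  end.

(** * Norms with real values and norm convergence of sequences *)

Section RealNorm.
Variables (R : realType) (V : normedModType R[i]).
Implicit Types (x y : V) (a : R[i]) (t : R).

Lemma rnormE x : `|x| = (rnorm x)%:C.
Proof. by rewrite /rnorm RRe_real // normr_real. Qed.

Lemma rnorm_ge0 x : 0 <= rnorm x.
Proof. by rewrite -lecR -rnormE normr_ge0. Qed.

Lemma rnorm0 : rnorm (0 : V) = 0.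
Proof. by rewrite /rnorm normr0. Qed.

Lemma rnorm_eq0 x : rnorm x = 0 -> x = 0.
Proof. by move=> x0; apply/normr0_eq0; rewrite rnormE x0. Qed.

Lemma rnormD x y : rnorm (x + y) <= rnorm x + rnorm y.
Proof. by rewrite -lecR rmorphD /= -!rnormE ler_normD. Qed.

Lemma rnormN x : rnorm (- x) = rnorm x.
Proof. by rewrite /rnorm normrN. Qed.

Lemma rnormB x y : rnorm (x - y) <= rnorm x + rnorm y.
Proof. by rewrite (le_trans (rnormD _ _)) // rnormN. Qed.

Lemma rdistC x y : rnorm (x - y) = rnorm (y - x).
Proof. by rewrite -rnormN opprB. Qed.

Lemma rnormZ a x : rnorm (a *: x) = complex.Re `|a| * rnorm x.
Proof.
by apply: complexI; rewrite rmorphM /= -!rnormE normrZ.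
Qed.

Lemma Re_normc_real t : complex.Re `|t%:C| = `|t|.
Proof. by rewrite normc_def /= expr0n /= addr0 sqrtr_sqr. Qed.

Lemma rnormZR t x : rnorm (t%:C *: x) = `|t| * rnorm x.
Proof. by rewrite rnormZ Re_normc_real. Qed.

Lemma rnorm_sum (I : Type) (s : seq I) (P : pred I) (F : I -> V) :
  rnorm (\sum_(i <- s | P i) F i) <= \sum_(i <- s | P i) rnorm (F i).
Proof.
elim/big_rec2: _ => [|i y x _ xy]; first by rewrite rnorm0.
by rewrite (le_trans (rnormD _ _)) // lerD2l.
Qed.

Definition rcvg (u : nat -> V) (l : V) :=
  forall e : R, 0 < e -> exists n0, forall n, (n0 <= n)%N -> rnorm (u n - l) <= e.

Lemma rcvg_le (u : nat -> V) l c :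
  rcvg u l -> (forall n, rnorm (u n) <= c) -> rnorm l <= c.
Proof.
move=> ul uc; apply/ler_addgt0Pr => e e0.
have [n0 /(_ _ (leqnn _)) h] := ul e e0.
rewrite -[l](subrKC (u n0)) (le_trans (rnormD _ _)) // lerD //.
by rewrite rdistC.
Qed.

Lemma rcvg_unique (u : nat -> V) l l' : rcvg u l -> rcvg u l' -> l = l'.
Proof.
move=> ul ul'; apply/subr0_eq/rnorm_eq0/le_anti; rewrite rnorm_ge0 andbT.
apply/ler_addgt0Pr => e e0.
have e20 : 0 < e / 2 by rewrite divr_gt0.
have [n0 h] := ul _ e20; have [n1 h'] := ul' _ e20.
have /h {}h := leq_maxl n0 n1; have /h' {}h' := leq_maxr n0 n1.
rewrite -[l - l'](subrKA (u (maxn n0 n1))) (le_trans (rnormD _ _)) // rdistC.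
by lra.
Qed.

End RealNorm.

Section Completeness.
Variables (R : realType) (V : completeNormedModType R[i]).

(* A Cauchy criterion: the increments of u are dominated by those of a bounded
   real sequence. *)
Lemma dominated_rcvg (u : nat -> V) (s : nat -> R) (c : R) :
  (forall n, rnorm (u n.+1 - u n) <= s n.+1 - s n) -> (forall n, s n <= c) ->
  exists l, rcvg u l.
Proof.
move=> us sc.
have s_nd n m : (n <= m)%N -> s n <= s m.
  move=> /subnK <-; elim: (m - n)%N => // k IH.
  by apply: (le_trans IH); rewrite addSn -subr_ge0 (le_trans _ (us _)) ?rnorm_ge0.
have us' n m : (n <= m)%N -> rnorm (u m - u n) <= s m - s n.
  move=> /subnK <-; elim: (m - n)%N => [|k IH]; first by rewrite !subrr rnorm0.
  rewrite addSn -(subrKA (u (k + n)%N) (u (k + n).+1)) (le_trans (rnormD _ _)) //.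
  by have := us (k + n)%N; lra.
have s_cvg : cvgn s.
  by apply: nondecreasing_is_cvgn => //; exists c => _ [n _ <-].
have s_le n : s n <= limn s by exact: nondecreasing_cvgn_le.
have s_lt (e : R) : 0 < e -> exists n, limn s - s n < e.
  move=> e0; have /cvgrPdist_lt /(_ e e0) [n _ /(_ n (leqnn n)) h] := s_cvg.
  by exists n; rewrite (le_lt_trans (ler_norm _)).
have u_lt (e : R) : 0 < e ->
    exists n0, forall m, (n0 <= m)%N -> rnorm (u n0 - u m) < e.
  move=> /s_lt[n0 n0e]; exists n0 => m /us'; rewrite rdistC => /le_lt_trans -> //.
  by rewrite (le_lt_trans _ n0e) // lerD2r.
have pos_real (e : R[i]) : 0 < e -> e = (complex.Re e)%:C /\ 0 < complex.Re e.
  by rewrite ltcE => /andP[/eqP h ->]; split => //; rewrite [LHS]complexE h mulr0 addr0.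
have : cauchy (u @ \oo).
  suff : cauchy_ex (u @ \oo) by exact: cauchy_exP.
  move=> e e0; have [-> /u_lt[n0 h]] := pos_real e e0.
  exists (u n0); exists n0 => // m /= /h.
  by rewrite -ball_normE /= rnormE ltcR.
move=> /cauchy_cvg u_cvg; exists (limn u) => e e0.
have /cvgrPdist_lt /(_ e%:C) := u_cvg.
rewrite ltcR => /(_ e0) [n0 _ h]; exists n0 => n /h /=.
by rewrite rnormE ltcR rdistC => /ltW.
Qed.

End Completeness.

(** * The involution, and square roots by iteration *)

Section StarAlgebra.
Variables (R : realType) (A : cstarAlgType R).
Implicit Types (x y z : A) (a : R[i]) (t : R).

Lemma starMr x y : star (x * y) = star y * star x.
Proof. exact: starM. Qed.

Lemma star0 : star (0 : A) = 0.
Proof. by apply: (addIr (star 0)); rewrite -starD !add0r. Qed.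

Lemma starN x : star (- x) = - star x.
Proof. by apply: (addrI (star x)); rewrite -starD !subrr star0. Qed.

Lemma starB x y : star (x - y) = star x - star y.
Proof. by rewrite starD starN. Qed.

Lemma star1 : star (1 : A) = 1.
Proof. by rewrite -[LHS]mulr1 -[X in _ * X]starK -starMr mulr1 starK. Qed.

Lemma starZc a x : star (a *: x) = conjc a *: star x.
Proof. by rewrite starZ. Qed.

Lemma starZR t x : star (t%:C *: x) = t%:C *: star x.
Proof. by rewrite starZc conjc_real. Qed.

Lemma star_sum (I : Type) (s : seq I) (P : pred I) (F : I -> A) :
  star (\sum_(i <- s | P i) F i) = \sum_(i <- s | P i) star (F i).
Proof. exact: (big_morph _ starD star0). Qed.

Lemma starX x n : star (x ^+ n) = star x ^+ n.
Proof. by elim: n => [|n IH]; rewrite ?star1 // exprSr starMr IH -exprS. Qed.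

Lemma rnormM x y : rnorm (x * y) <= rnorm x * rnorm y.
Proof. by rewrite -lecR rmorphM /= -!rnormE cnormM. Qed.

Lemma rnorm_starM x : rnorm (star x * x) = rnorm x ^+ 2.
Proof. by apply: complexI; rewrite rmorphXn /= -!rnormE cstar_identity. Qed.

Lemma rnorm_star x : rnorm (star x) = rnorm x.
Proof.
have h y : rnorm y <= rnorm (star y).
  have [->|/eqP y0] := eqVneq (rnorm y) 0; first exact: rnorm_ge0.
  have y_gt0 : 0 < rnorm y by rewrite lt_neqAle rnorm_ge0 eq_sym andbT; apply/eqP.
  by rewrite -(ler_pM2r y_gt0) -expr2 -rnorm_starM rnormM.
by apply/le_anti; rewrite h andbT -{2}[x]starK h.
Qed.

Lemma rnorm1_le : rnorm (1 : A) <= 1.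
Proof.
have := rnorm_starM 1; rewrite star1 mulr1 expr2 => h.
have [->|/eqP n0] := eqVneq (rnorm (1 : A)) 0; first exact: ler01.
have n_gt0 : 0 < rnorm (1 : A) by rewrite lt_neqAle rnorm_ge0 eq_sym andbT; apply/eqP.
by rewrite -(ler_pM2r n_gt0) -h mul1r.
Qed.

Lemma rnorm_realA t : 0 <= t -> rnorm (t%:C *: (1 : A)) <= t.
Proof.
by move=> t0; rewrite rnormZR ger0_norm // -[leRHS]mulr1 ler_wpM2l // rnorm1_le.
Qed.

Lemma rnorm_starM_eq0 x : star x * x = 0 -> x = 0.
Proof.
move=> h; apply: rnorm_eq0; have := rnorm_starM x; rewrite h rnorm0.
by move/esym/eqP; rewrite sqrf_eq0 => /eqP.
Qed.

Definition selfadj x := star x = x.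

Lemma selfadj0 : selfadj 0. Proof. exact: star0. Qed.
Lemma selfadj1 : selfadj 1. Proof. exact: star1. Qed.
Lemma selfadjD x y : selfadj x -> selfadj y -> selfadj (x + y).
Proof. by rewrite /selfadj starD => -> ->. Qed.
Lemma selfadjN x : selfadj x -> selfadj (- x).
Proof. by rewrite /selfadj starN => ->. Qed.
Lemma selfadjB x y : selfadj x -> selfadj y -> selfadj (x - y).
Proof. by move=> hx hy; apply/selfadjD/selfadjN. Qed.
Lemma selfadjZ t x : selfadj x -> selfadj (t%:C *: x).
Proof. by rewrite /selfadj starZR => ->. Qed.
Lemma selfadjM x y : selfadj x -> selfadj y -> x * y = y * x -> selfadj (x * y).
Proof. by rewrite /selfadj starMr => -> -> ->. Qed.
Lemma selfadj_starM x : selfadj (star x * x).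
Proof. by rewrite /selfadj starMr starK. Qed.
Lemma rnorm_sqr x : selfadj x -> rnorm (x * x) = rnorm x ^+ 2.
Proof. by move=> sx; rewrite -rnorm_starM sx. Qed.

Lemma rcvg_selfadj (u : nat -> A) x :
  rcvg u x -> (forall n, selfadj (u n)) -> selfadj x.
Proof.
move=> ux su; apply: (rcvg_unique _ ux) => e /ux[n0 h]; exists n0 => n /h.
by rewrite -rnorm_star starB su.
Qed.

Lemma rcvgMl (u : nat -> A) x y : rcvg u x -> rcvg (fun n => y * u n) (y * x).
Proof.
move=> ux e e0; have d0 : 0 < rnorm y + 1 by rewrite ltr_wpDl ?rnorm_ge0.
have [n0 h] := ux (e / (rnorm y + 1)) (divr_gt0 e0 d0).
exists n0 => n /h h'; rewrite -mulrBr (le_trans (rnormM _ _)) //.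
rewrite (le_trans (ler_wpM2l (rnorm_ge0 _) h')) // mulrCA ger_pMr //.
by rewrite ler_pdivrMr // mul1r lerDl.
Qed.

Lemma rcvgMr (u : nat -> A) x y : rcvg u x -> rcvg (fun n => u n * y) (x * y).
Proof.
move=> ux e /(rcvgMl (star y) _)-/(_ (star \o u) (star x))[|n0 h].
  by move=> d /ux[n0 h]; exists n0 => n /h; rewrite -rnorm_star starB.
by exists n0 => n /h; rewrite -rnorm_star starB !starMr !starK.
Qed.

Lemma rcvg_comm (u : nat -> A) x y :
  rcvg u x -> (forall n, y * u n = u n * y) -> y * x = x * y.
Proof.
move=> ux uy; apply: (rcvg_unique (rcvgMl y ux)).
by rewrite (_ : (fun n => _) = (fun n => u n * y)); [exact: rcvgMr | apply/funext].
Qed.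

(* The square root of 1 - z is 1 - y, where y is the limit of the iteration
   y |-> (z + y^2)/2; its increments are dominated by those of the same
   iteration on the real number 1. *)
Fixpoint sqrt_iter z n : A :=
  if n is n.+1 then 2^-1%:C *: (z + sqrt_iter z n * sqrt_iter z n) else 0.

Fixpoint sqrt_iter1 n : R :=
  if n is n.+1 then (1 + sqrt_iter1 n ^+ 2) / 2 else 0.

Lemma sqrt_iter1_bounds n : 0 <= sqrt_iter1 n <= 1.
Proof. by elim: n => [|n /andP[h1 h2]] /=; [rewrite lexx ler01 | apply/andP; nra]. Qed.

Lemma sqrt_iter_comm z n y : y * z = z * y -> y * sqrt_iter z n = sqrt_iter z n * y.
Proof.
move=> yz; elim: n => [|n IH] /=; first by rewrite mulr0 mul0r.
by rewrite scaleAr scaleAl mulrDr mulrDl yz mulrA IH -mulrA IH mulrA.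
Qed.

Lemma sqrt_iter_selfadj z n : selfadj z -> selfadj (sqrt_iter z n).
Proof.
move=> sz; elim: n => [|n IH] /=; first exact: selfadj0.
by apply/selfadjZ/selfadjD => //; apply: selfadjM.
Qed.

Lemma rnorm_sqrt_iter z n : rnorm z <= 1 -> rnorm (sqrt_iter z n) <= sqrt_iter1 n.
Proof.
move=> z1; elim: n => [|n IH] /=; first by rewrite rnorm0.
rewrite rnormZR ger0_norm ?invr_ge0 ?ler0n // mulrC ler_wpM2r ?invr_ge0 ?ler0n //.
rewrite (le_trans (rnormD _ _)) // lerD // (le_trans (rnormM _ _)) // expr2.
by rewrite ler_pM ?rnorm_ge0.
Qed.

Lemma sqrt_iterB z n : rnorm z <= 1 ->
  rnorm (sqrt_iter z n.+1 - sqrt_iter z n) <= sqrt_iter1 n.+1 - sqrt_iter1 n.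
Proof.
move=> z1; elim: n => [|n IH].
  rewrite /= mul0r addr0 !subr0 rnormZR ger0_norm ?invr_ge0 ?ler0n //.
  by rewrite expr0n addr0 mulrC ler_wpM2r ?invr_ge0 ?ler0n.
have zC m : sqrt_iter z m * z = z * sqrt_iter z m.
  by rewrite (sqrt_iter_comm m (erefl (z * z))).
have pq := sqrt_iter_comm n (zC n.+1).
have p1 := rnorm_sqrt_iter n.+1 z1; have q1 := rnorm_sqrt_iter n z1.
have E k : sqrt_iter z k.+1 = 2^-1%:C *: (z + sqrt_iter z k * sqrt_iter z k) by [].
have E1 k : sqrt_iter1 k.+1 = (1 + sqrt_iter1 k ^+ 2) / 2 by [].
rewrite (E n.+1) {3}(E n) (E1 n.+1) {2}(E1 n).
move: (sqrt_iter z n.+1) (sqrt_iter z n) (sqrt_iter1 n.+1) (sqrt_iter1 n) IH pq p1 q1.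
move=> p q s t IH pq p1 q1.
(* [ncring] knows no commutation relation, so the commutator is kept as a separate summand and then
   removed by [pq]. The same device recurs below. *)
have -> : 2^-1%:C *: (z + p * p) - 2^-1%:C *: (z + q * q) =
    2^-1%:C *: ((p + q) * (p - q)) + 2^-1%:C *: (p * q - q * p).
  by ncring.
rewrite pq subrr scaler0 addr0 rnormZR ger0_norm ?invr_ge0 ?ler0n //.
have h := ler_pM (rnorm_ge0 _) (rnorm_ge0 _) (le_trans (rnormD p q) (lerD p1 q1)) IH.
by have := rnormM (p + q) (p - q); nra.
Qed.

(** The part of functional calculus that is kept: membership in the bicommutant makes roots of
    commuting elements commute. *)
Definition bicomm z y := forall x, x * z = z * x -> x * y = y * x.

Lemma sqrt_1B z : selfadj z -> rnorm z <= 1 ->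
  exists y, [/\ selfadj y, rnorm y <= 1, bicomm z y & (1 - y) * (1 - y) = 1 - z].
Proof.
move=> sz z1.
have [y uy] := dominated_rcvg (fun n => sqrt_iterB n z1)
  (fun n => (andP (sqrt_iter1_bounds n)).2).
have b m : rnorm (sqrt_iter z m) <= 1.
  by rewrite (le_trans (rnorm_sqrt_iter m z1)) //; case/andP: (sqrt_iter1_bounds m).
have yb := rcvg_le uy b.
exists y; split=> //.
- by apply: rcvg_selfadj uy _ => n; apply: sqrt_iter_selfadj.
- by move=> x xz; apply: (rcvg_comm uy) => n; apply: sqrt_iter_comm.
have : y = 2^-1%:C *: (z + y * y).
  apply: (rcvg_unique (u := fun n => sqrt_iter z n.+1)).
    by move=> e /uy[n0 h]; exists n0 => n n0n; apply/h/leqW.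
  move=> e e0; have [n0 h] := uy e e0; exists n0 => n n0n /=.
  have uC : sqrt_iter z n * y = y * sqrt_iter z n.
    apply: (rcvg_comm uy) => m; apply: sqrt_iter_comm.
    by rewrite (sqrt_iter_comm n (erefl (z * z))).
  have -> : 2^-1%:C *: (z + sqrt_iter z n * sqrt_iter z n) - 2^-1%:C *: (z + y * y) =
      2^-1%:C *: ((sqrt_iter z n + y) * (sqrt_iter z n - y)) +
      2^-1%:C *: (sqrt_iter z n * y - y * sqrt_iter z n).
    by ncring.
  rewrite uC subrr scaler0 addr0 rnormZR ger0_norm ?invr_ge0 ?ler0n //.
  have h2 : rnorm (sqrt_iter z n + y) <= 2.
    by rewrite (le_trans (rnormD _ _)) // -[2]/(1 + 1) lerD.
  have h1 := rnormM (sqrt_iter z n + y) (sqrt_iter z n - y).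
  have := ler_pM (rnorm_ge0 _) (rnorm_ge0 _) h2 (h n n0n).
  by lra.
move=> yE; have -> : (1 - y) * (1 - y) = 1 - 2%:C *: y + y * y by ncring.
by rewrite {1}yE; ncring.
Qed.

End StarAlgebra.

(** * The positive cone *)

Section Positivity.
Variables (R : realType) (A : cstarAlgType R).
Implicit Types (x y z a b p : A) (s t e : R).

Definition psq x := exists2 y, selfadj y & x = y * y.

(* a + ib is unitary up to the factor t. *)
Lemma rnorm_sqr_sum a b t : selfadj a -> selfadj b -> a * b = b * a ->
  a * a + b * b = t%:C *: (1 : A) -> 0 <= t -> rnorm b ^+ 2 <= t.
Proof.
move=> sa sb ab E t0; set u := a + 'i *: b.
have su : star u = a - 'i *: b.
  by rewrite /u starD starZc sa sb -scaleNr; congr (_ + _ *: _); apply/eqP; rewrite eq_complex /= oppr0 !eqxx.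
have i2 : 'i * 'i = -1 :> R[i] by rewrite -expr2 sqr_i.
have Nu : rnorm u ^+ 2 <= t.
  rewrite -rnorm_starM su; apply: le_trans (rnorm_realA A t0); rewrite -E.
  have -> // : (a - 'i *: b) * u = a * a + b * b.
  have -> : (a - 'i *: b) * u = a * a + 'i *: (a * b - b * a) - ('i * 'i) *: (b * b).
    by rewrite /u; ncring.
  by rewrite ab subrr scaler0 addr0 i2 scaleN1r opprK.
apply: le_trans Nu; rewrite ler_sqr ?nnegrE ?rnorm_ge0 //.
have -> : b = 2^-1%:C *: (- 'i *: (u - star u)).
  rewrite su /u.
  have -> : 2^-1%:C *: (- 'i *: (a + 'i *: b - (a - 'i *: b))) =
    (- ('i * 'i)) *: b by ncring.
  by rewrite i2 opprK scale1r.
rewrite rnormZR ger0_norm ?invr_ge0 // rnormZ normrN.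
have -> : complex.Re `|'i : R[i]| = 1.
  by rewrite normc_def /= expr0n expr1n add0r sqrtr1.
have := rnormB u (star u); rewrite rnorm_star; lra.
Qed.

Lemma psq_selfadj x : psq x -> selfadj x.
Proof. by case=> y sy ->; apply: selfadjM. Qed.

Lemma psq_sqr y : selfadj y -> psq (y * y).
Proof. by exists y. Qed.

Lemma psq0 : psq 0.
Proof. by exists 0; [exact: selfadj0 | rewrite mulr0]. Qed.

(** Half of the norm criterion for positivity: [x / t] is [1 - z] with z in the unit ball, and
    [sqrt_1B] gives its root. The bound on the root is the same criterion with [Num.sqrt t], so the
    root is itself positive. *)
Lemma psq_root x t : selfadj x -> rnorm (t%:C *: (1 : A) - x) <= t ->
  exists y, [/\ selfadj y, rnorm ((Num.sqrt t)%:C *: (1 : A) - y) <= Num.sqrt t,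
    bicomm x y & x = y * y].
Proof.
move=> sx xt; have := le_trans (rnorm_ge0 _) xt; rewrite le_eqVlt => /predU1P[t0|t0].
  exists 0; split; [exact: selfadj0 | by rewrite -t0 sqrtr0 scale0r subr0 rnorm0 | by move=> z _; rewrite mulr0 mul0r |].
  rewrite mulr0; apply/oppr_inj; rewrite oppr0; apply/rnorm_eq0/le_anti.
  by rewrite rnorm_ge0 andbT; move: xt; rewrite -t0 scale0r add0r.
have tn : t%:C != 0 by rewrite (inj_eq (@complexI R) t 0) gt_eqF.
have zE : 1 - t^-1%:C *: x = t^-1%:C *: (t%:C *: (1 : A) - x).
  by rewrite scalerBr scalerA -rmorphM /= mulVf ?gt_eqF // scale1r.
have [||y [sy y1 cy yE]] := @sqrt_1B R A (1 - t^-1%:C *: x).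
- by apply: selfadjB; [exact: selfadj1 | exact: selfadjZ].
- rewrite zE rnormZR ger0_norm ?invr_ge0 ?(ltW t0) //.
  by rewrite ler_pdivrMl // mulr1.
exists ((Num.sqrt t)%:C *: (1 - y)); split.
- by apply/selfadjZ/selfadjB => //; exact: selfadj1.
- by rewrite -scalerBr subKr rnormZR ger0_norm // -[leRHS]mulr1 ler_wpM2l.
- move=> z xz; rewrite scaleAl scaleAr mulrBl mulrBr mul1r mulr1 cy //.
  by rewrite mulrBl mulrBr mul1r mulr1 scaleAl scaleAr xz.
rewrite scaleAl scaleAr yE subKr !scalerA -!rmorphM /= -(expr2 (Num.sqrt t)).
by rewrite sqr_sqrtr ?(ltW t0) // mulfV ?gt_eqF // scale1r.
Qed.

Lemma psqP x t : selfadj x -> rnorm (t%:C *: (1 : A) - x) <= t -> psq x.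
Proof. by move=> sx /(psq_root sx)[y [sy _ _ xy]]; exists y. Qed.

Lemma psqZ t x : 0 <= t -> psq x -> psq (t%:C *: x).
Proof.
move=> t0 [y sy ->]; exists ((Num.sqrt t)%:C *: y); first exact: selfadjZ.
by rewrite scaleAl scaleAr scalerA -rmorphM /= -(expr2 (Num.sqrt t)) sqr_sqrtr.
Qed.

(** Converse of the criterion. If [x = a * a], a root [b] of [t - x] can be chosen to commute with
    [a]; then [a * a + b * b = t], and [rnorm_sqr_sum] bounds [b]. *)
Lemma psq_rnorm x t : psq x -> rnorm x <= t -> rnorm (t%:C *: (1 : A) - x) <= t.
Proof.
move=> px xt; have := le_trans (rnorm_ge0 _) xt; rewrite le_eqVlt => /predU1P[t0|t0].
  by rewrite -t0 scale0r add0r rnormN t0.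
have [a sa xE] := px.
have tn : t%:C != 0 by rewrite (inj_eq (@complexI R) t 0) gt_eqF.
have [||y [sy y1 cy yE]] := @sqrt_1B R A (t^-1%:C *: x).
- exact/selfadjZ/psq_selfadj.
- rewrite rnormZR ger0_norm ?invr_ge0 ?(ltW t0) //.
  by rewrite ler_pdivrMl // mulr1.
set b := (Num.sqrt t)%:C *: (1 - y).
have bb : b * b = t%:C *: (1 : A) - x.
  rewrite /b scaleAl scaleAr yE !scalerA -!rmorphM /= -(expr2 (Num.sqrt t)).
  rewrite sqr_sqrtr ?(ltW t0) // scalerBr scalerA -rmorphM /= mulfV ?gt_eqF //.
  by rewrite scale1r.
have sb : selfadj b by apply/selfadjZ/selfadjB => //; exact: selfadj1.
have ab : a * b = b * a.
  rewrite /b scaleAl scaleAr mulrBl mulrBr mul1r mulr1 cy //.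
  by rewrite scaleAl scaleAr xE mulrA.
rewrite -bb rnorm_sqr //; apply: (rnorm_sqr_sum sa sb ab) (ltW t0).
by rewrite bb -xE subrKC.
Qed.

(** A sum of squares has no visible root, but the criterion |t - x| <= t is additive in t and x. *)
Lemma psqD x y : psq x -> psq y -> psq (x + y).
Proof.
move=> px py; apply: (@psqP _ (rnorm x + rnorm y)).
  by apply: selfadjD; exact: psq_selfadj.
rewrite rmorphD /= scalerDl opprD addrACA.
by rewrite (le_trans (rnormD _ _)) // lerD // psq_rnorm.
Qed.

Lemma psq_sum (I : Type) (r : seq I) (P : pred I) (F : I -> A) :
  (forall i, P i -> psq (F i)) -> psq (\sum_(i <- r | P i) F i).
Proof. by move=> h; elim/big_ind: _ => //; [exact: psq0 | exact: psqD]. Qed.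

Lemma psq1 : psq 1.
Proof. by exists 1; [exact: selfadj1 | rewrite mulr1]. Qed.

Lemma psq_subr x t : selfadj x -> rnorm x <= t -> psq (t%:C *: (1 : A) - x).
Proof.
move=> sx xt; apply: (@psqP _ t); last by rewrite subKr.
by apply: selfadjB => //; apply/selfadjZ/selfadj1.
Qed.

Lemma psq_bicomm_root x : psq x -> exists y, [/\ psq y, bicomm x y & x = y * y].
Proof.
move=> px; have [||y [sy yt cy yE]] := @psq_root x (rnorm x).
- exact: psq_selfadj.
- exact: psq_rnorm.
by exists y; split => //; apply: psqP yt.
Qed.

Lemma psq_comm_mul x y : psq x -> psq y -> x * y = y * x -> psq (x * y).
Proof.
move=> /psq_bicomm_root[a [/psq_selfadj sa ca xE]].
move=> /psq_bicomm_root[b [/psq_selfadj sb cb yE]] xy.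
have ab : a * b = b * a by apply: cb; symmetry; apply: ca.
rewrite xE yE.
exists (a * b); first exact: selfadjM.
by rewrite !mulrA -(mulrA a b a) -ab !mulrA.
Qed.

(** With t = |x|, the shift by e cancels in (t + e) - (x + e), so the criterion yields |t - x| <= t
    + e for every e > 0. *)
Lemma psq_closed x : (forall e, 0 < e -> psq (x + e%:C *: (1 : A))) -> psq x.
Proof.
move=> h; have sx : selfadj x.
  have := psq_selfadj (h 1 ltr01); rewrite /selfadj starD starZR star1.
  exact: addIr.
apply: (@psqP _ (rnorm x)) => //; apply/ler_addgt0Pr => e e0.
have /psq_rnorm/(_ (le_trans (rnormD _ _) (lerD (lexx _) (rnorm_realA A (ltW e0))))) := h e e0.
by rewrite rmorphD /= scalerDl opprD addrACA subrr addr0.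
Qed.

Lemma psq_antisym p : psq p -> psq (- p) -> p = 0.
Proof.
move=> pp pn.
have [a [/psq_selfadj sa ca pa]] := psq_bicomm_root pp.
have [b [/psq_selfadj sb cb pb]] := psq_bicomm_root pn.
have ab : a * b = b * a.
  by apply: cb; rewrite mulrN mulNr pa mulrA.
have : rnorm b ^+ 2 <= 0.
  by apply: (rnorm_sqr_sum sa sb ab) => //; rewrite -pa -pb subrr scale0r.
rewrite exprn_even_le0 // => /eqP/rnorm_eq0 b0.
by apply/oppr_inj; rewrite pb b0 mulr0 oppr0.
Qed.

Lemma selfadj_sqr_eq0 x : selfadj x -> x * x = 0 -> x = 0.
Proof. by move=> sx xx; apply: rnorm_starM_eq0; rewrite sx. Qed.

(* With r the root of x and n = m r one has n * star n = - (m * star m)^2 and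
   star n * n = - x^2, while n * star n + star n * n is twice a sum of two
   squares of selfadjoint elements. *)
Lemma star_mul_opp m x : star m * m = - x -> psq x -> m = 0.
Proof.
move=> mE px; have [r [/psq_selfadj sr cr xE]] := psq_bicomm_root px.
have key n y z : star n * n = - y -> n * star n = - z -> psq y -> psq z -> y = 0.
  move=> nE nE' py pz; apply: psq_antisym => //.
  pose h := 2^-1%:C *: (n + star n); pose k := (2^-1%:C * 'i) *: (star n - n).
  have sh : selfadj h by rewrite /h /selfadj starZR starD starK addrC.
  have sk : selfadj k.
    rewrite /k /selfadj starZc starB starK -[RHS]opprK -scalerN opprB -scaleNr.
    congr (_ *: _); apply/eqP.
    by rewrite eq_complex /=; apply/andP; split; apply/eqP; ring.
  have i2 : 'i * 'i = -1 :> R[i] by rewrite -expr2 sqr_i.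
  have E : star n * n + n * star n = 2%:C *: (h * h + k * k).
    have -> : k * k = (2^-1%:C * 2^-1%:C * ('i * 'i)) *: ((star n - n) * (star n - n)).
      by rewrite /k; ncring.
    by rewrite i2 /h; ncring.
  have -> : - y = 2%:C *: (h * h + k * k) + z by rewrite -E nE nE' subrK.
  apply: psqD => //; apply: psqZ; first exact: ler0n.
  by apply: psqD; exact: psq_sqr.
have sx := psq_selfadj px.
have sm : selfadj (m * star m) by rewrite /selfadj starMr starK.
have xx0 : x * x = 0.
  apply: (key (m * r) _ ((m * star m) * (m * star m))).
  - rewrite starMr sr mulrA -[r * star m * m]mulrA mE mulrN mulNr.
    have -> : r * x = x * r by rewrite xE mulrA.
    by rewrite -mulrA -xE.
  - rewrite starMr sr mulrA -[m * r * r]mulrA -xE -[x]opprK -mE mulrN mulNr.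
    by rewrite !mulrA.
  - exact: psq_sqr.
  - exact: psq_sqr.
apply: rnorm_starM_eq0; rewrite mE (selfadj_sqr_eq0 sx) ?oppr0 //.
Qed.

(* Kelley and Vaught.  With c = |x| and f = c - x one has x f = - c f, so that
   star_mul_opp applies to y f. *)
Lemma psq_starM y : psq (star y * y).
Proof.
set x := star y * y; have sx : selfadj x by exact: selfadj_starM.
have [c [pc cc cE]] := psq_bicomm_root (psq_sqr sx).
have sc := psq_selfadj pc.
have xc : x * c = c * x by apply: cc; rewrite mulrA.
pose f := c - x.
have sf : selfadj f by exact: selfadjB.
have xf : x * f = - (c * f) by rewrite /f !mulrBr cE xc opprB.
have fx : f * x = x * f by rewrite /f mulrBr mulrBl xc.
have fc : f * c = c * f by rewrite /f mulrBr mulrBl xc.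
have [r [/psq_selfadj sr cr rE]] := psq_bicomm_root pc.
have pfcf : psq (f * c * f).
  rewrite rE -[_ * f]mulrA -(mulrA r) mulrA.
  have fr : f * r = r * f by exact: cr.
  by rewrite -fr; apply: psq_sqr; apply: selfadjM.
have yf : star (y * f) * (y * f) = - (f * c * f).
  by rewrite starMr sf mulrA -[f * star y * y]mulrA -/x -mulrA xf mulrN mulrA.
have yf0 := star_mul_opp yf pfcf.
have xf0 : x * f = 0 by rewrite /x -mulrA yf0 mulr0.
have ff : f * f = 0 by rewrite {1}/f mulrBl xf0 -[c * f]opprK -xf xf0 oppr0 addr0.
have /eqP := selfadj_sqr_eq0 sf ff.
by rewrite subr_eq0 => /eqP <-.
Qed.

Lemma psq_conj x v : psq x -> psq (star v * x * v).
Proof.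
move=> [y sy ->]; have -> : star v * (y * y) * v = star (y * v) * (y * v).
  by rewrite starMr sy !mulrA.
exact: psq_starM.
Qed.

Lemma psq_trans x y z : psq (y - x) -> psq (z - y) -> psq (z - x).
Proof. by move=> xy yz; rewrite -(subrKA y); exact: psqD. Qed.

(** Since [t - x] is the sum of [t - y] and [y - x], it has a root commuting with the root of [x];
    their squares add up to [t], and [rnorm_sqr_sum] applies again. *)
Lemma psq_le_rnorm x y t : psq x -> psq (y - x) -> rnorm y <= t -> rnorm x <= t.
Proof.
move=> px pyx yt; have t0 := le_trans (rnorm_ge0 _) yt.
have py : psq y by rewrite -[y](subrK x); exact: psqD.
have [a [/psq_selfadj sa ca aE]] := psq_bicomm_root px.
have ptx : psq (t%:C *: (1 : A) - x).
  exact: psq_trans pyx (psq_subr (psq_selfadj py) yt).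
have [b [/psq_selfadj sb cb bE]] := psq_bicomm_root ptx.
rewrite aE rnorm_sqr //; apply: (rnorm_sqr_sum sb sa) => //.
  symmetry; apply: cb.
  by rewrite mulrBr mulrBl scaleAr scaleAl mulr1 mul1r aE mulrA.
by rewrite -aE -bE subrK.
Qed.

Lemma psq_rnorm_le x y : psq x -> psq (y - x) -> rnorm x <= rnorm y.
Proof. by move=> px pyx; exact: psq_le_rnorm px pyx _. Qed.

End Positivity.

(** * The Hilbert module A^n and the C*-norm of matrices *)

Section HilbertModule.
Variables (R : realType) (A : cstarAlgType R).

Definition dot n (v w : 'cV[A]_n) : A := \sum_i star (v i 0) * w i 0.

Lemma dotE n (v w : 'cV[A]_n) : (adjmx v *m w) 0 0 = dot v w.
Proof. by rewrite mxE; apply: eq_bigr => i _; rewrite !mxE. Qed.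

Lemma dotDr n (v w w' : 'cV[A]_n) : dot v (w + w') = dot v w + dot v w'.
Proof. by rewrite /dot -big_split; apply: eq_bigr => i _; rewrite mxE mulrDr. Qed.

Lemma dot_star n (v w : 'cV[A]_n) : star (dot v w) = dot w v.
Proof. by rewrite star_sum; apply: eq_bigr => i _; rewrite starMr starK. Qed.

Lemma psq_dot n (v : 'cV[A]_n) : psq (dot v v).
Proof. by apply: psq_sum => i _; exact: psq_starM. Qed.

(** Scalars act on the right, so that matrices, acting on the left, are module maps. *)
Definition vscale n (v : 'cV[A]_n) (a : A) : 'cV[A]_n := \col_i (v i 0 * a).

Lemma dot_vscaler n (v w : 'cV[A]_n) a : dot v (vscale w a) = dot v w * a.
Proof. by rewrite /dot mulr_suml; apply: eq_bigr => i _; rewrite mxE mulrA. Qed.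

Lemma dot_vscalel n (v w : 'cV[A]_n) a : dot (vscale v a) w = star a * dot v w.
Proof. by rewrite -dot_star dot_vscaler starMr dot_star. Qed.

Lemma dotDl n (v v' w : 'cV[A]_n) : dot (v + v') w = dot v w + dot v' w.
Proof. by rewrite -dot_star dotDr starD !dot_star. Qed.

Lemma dot0_eq0 n (v : 'cV[A]_n) : dot v v = 0 -> v = 0.
Proof.
move=> v0; apply/matrixP => i j; rewrite ord1 mxE; apply: rnorm_starM_eq0.
apply: rnorm_eq0; apply/le_anti; rewrite rnorm_ge0 andbT -(rnorm0 A) -v0.
apply: psq_rnorm_le; first exact: psq_starM.
by rewrite /dot (bigD1 i) //= addrAC subrr add0r; apply: psq_sum => k _; exact: psq_starM.
Qed.

(** With t = |<v, v>| and s = <v, w>, expand the inner square of w t - v s. Adding the positive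
    element star s (t - <v, v>) s replaces <v, v> by the scalar t and leaves t (t <w, w> - star s s)
    >= 0. *)
Lemma dot_Cauchy_Schwarz n (v w : 'cV[A]_n) :
  rnorm (dot v w) ^+ 2 <= rnorm (dot v v) * rnorm (dot w w).
Proof.
set t := rnorm (dot v v); have := rnorm_ge0 (dot v v).
rewrite -/t le_eqVlt => /predU1P[t0|t0].
  have /dot0_eq0 -> : dot v v = 0 by exact: rnorm_eq0.
  rewrite /dot big1 ?rnorm0 ?expr0n ?mulr_ge0 ?rnorm_ge0 // => i _.
  by rewrite mxE star0 mul0r.
set s := dot v w; have sE : star s = dot w v by rewrite dot_star.
have p1 := psq_dot (vscale w (t%:C *: (1 : A)) + vscale v (- s)).
have p2 := psq_conj s (psq_subr (psq_selfadj (psq_dot v)) (lexx t)).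
have p : psq (t%:C *: (t%:C *: dot w w - star s * s)).
  have -> : t%:C *: (t%:C *: dot w w - star s * s) =
     dot (vscale w (t%:C *: (1 : A)) + vscale v (- s))
      (vscale w (t%:C *: (1 : A)) + vscale v (- s)) +
     star s * (t%:C *: (1 : A) - dot v v) * s.
    rewrite dotDl !dotDr !(dot_vscalel, dot_vscaler) -/s -sE starZR star1 starN.
    by ncring.
  exact: psqD.
have : psq (t%:C *: dot w w - star s * s).
  have := psqZ _ p; move=> /(_ t^-1); rewrite invr_ge0 scalerA -rmorphM /=.
  by rewrite mulVf ?gt_eqF // scale1r; apply; exact: ltW.
move=> /(psq_rnorm_le (psq_starM s)).
by rewrite rnorm_starM rnormZR gtr0_norm.
Qed.

Lemma hilb_norm_ge0 n (v : 'cV[A]_n) : 0 <= hilb_norm v.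
Proof. exact: sqrtr_ge0. Qed.

Lemma sqr_hilb_norm n (v : 'cV[A]_n) : hilb_norm v ^+ 2 = rnorm (dot v v).
Proof. by rewrite sqr_sqrtr ?rnorm_ge0 // dotE. Qed.

Lemma rnorm_dot_le n (v w : 'cV[A]_n) :
  rnorm (dot v w) <= hilb_norm v * hilb_norm w.
Proof.
rewrite -ler_sqr ?nnegrE ?rnorm_ge0 ?mulr_ge0 ?hilb_norm_ge0 //.
by rewrite exprMn !sqr_hilb_norm dot_Cauchy_Schwarz.
Qed.

Lemma rnorm_le_hilb n (v : 'cV[A]_n) i : rnorm (v i 0) <= hilb_norm v.
Proof.
rewrite -ler_sqr ?nnegrE ?rnorm_ge0 ?hilb_norm_ge0 // sqr_hilb_norm -rnorm_starM.
apply: psq_rnorm_le; first exact: psq_starM.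
by rewrite /dot (bigD1 i) //= addrAC subrr add0r; apply: psq_sum => k _; exact: psq_starM.
Qed.

Lemma hilb_norm_eq0 n (v : 'cV[A]_n) : hilb_norm v = 0 -> v = 0.
Proof.
move=> v0; apply/dot0_eq0/rnorm_eq0.
by rewrite -sqr_hilb_norm v0 expr0n.
Qed.

Lemma hilb_norm0 n : hilb_norm (0 : 'cV[A]_n) = 0.
Proof.
apply/eqP; rewrite -sqrf_eq0 sqr_hilb_norm /dot big1 ?rnorm0 // => i _.
by rewrite mxE mulr0.
Qed.

Lemma hilb_norm_vscaleR n (v : 'cV[A]_n) t : 0 <= t ->
  hilb_norm (vscale v (t%:C *: (1 : A))) = t * hilb_norm v.
Proof.
move=> t0; apply/eqP; rewrite -(@eqrXn2 _ 2) ?hilb_norm_ge0 ?mulr_ge0 ?hilb_norm_ge0 //.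
rewrite exprMn !sqr_hilb_norm dot_vscalel dot_vscaler starZR star1.
by rewrite scaleAl scaleAr mul1r mulr1 !rnormZR !ger0_norm // mulrA.
Qed.

Lemma mulmx_vscale n (X : 'M[A]_n) (v : 'cV[A]_n) a :
  X *m vscale v a = vscale (X *m v) a.
Proof.
apply/matrixP => i j; rewrite !mxE mulr_suml; apply: eq_bigr => k _.
by rewrite mxE mulrA.
Qed.

Lemma hilb_norm_bound n (v : 'cV[A]_n) c :
  (forall i, rnorm (v i 0) <= c i) -> hilb_norm v <= Num.sqrt (\sum_i c i ^+ 2).
Proof.
move=> vc; rewrite ler_wsqrtr // dotE (le_trans (rnorm_sum _ _ _)) //.
apply: ler_sum => i _; rewrite rnorm_starM.
by rewrite ler_sqr ?nnegrE ?rnorm_ge0 // (le_trans (rnorm_ge0 _) (vc i)).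
Qed.

(** Ensures that the [sup] in [cstar_mxnorm] is a genuine least upper bound and not the default
    value taken on unbounded sets. *)
Lemma hilb_norm_mx_bound n (X : 'M[A]_n) : exists c, forall v : 'cV[A]_n,
  hilb_norm v <= 1 -> hilb_norm (X *m v) <= c.
Proof.
exists (Num.sqrt (\sum_i (\sum_j rnorm (X i j)) ^+ 2)) => v v1.
apply: hilb_norm_bound => i; rewrite mxE (le_trans (rnorm_sum _ _ _)) //.
apply: ler_sum => j _; rewrite (le_trans (rnormM _ _)) //.
by rewrite -[leRHS]mulr1 ler_wpM2l ?rnorm_ge0 // (le_trans (rnorm_le_hilb _ _)).
Qed.

Lemma cstar_mxnorm_ub1 n (X : 'M[A]_n) (v : 'cV[A]_n) :
  hilb_norm v <= 1 -> hilb_norm (X *m v) <= cstar_mxnorm X.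
Proof.
move=> v1; apply: ub_le_sup; last by exists v.
by have [c h] := hilb_norm_mx_bound X; exists c => _ [w /h + <-].
Qed.

Lemma cstar_mxnorm_ge0 n (X : 'M[A]_n) : 0 <= cstar_mxnorm X.
Proof.
by rewrite (le_trans _ (@cstar_mxnorm_ub1 _ X 0 _)) ?hilb_norm_ge0 ?hilb_norm0 ?ler01.
Qed.

Lemma cstar_mxnorm_ub n (X : 'M[A]_n) (v : 'cV[A]_n) :
  hilb_norm (X *m v) <= cstar_mxnorm X * hilb_norm v.
Proof.
have := hilb_norm_ge0 v; rewrite le_eqVlt => /predU1P[v0|v0].
  by rewrite -v0 (hilb_norm_eq0 (esym v0)) mulmx0 hilb_norm0 mulr0.
have := @cstar_mxnorm_ub1 _ X (vscale v ((hilb_norm v)^-1%:C *: (1 : A))).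
rewrite mulmx_vscale !hilb_norm_vscaleR ?invr_ge0 ?hilb_norm_ge0 // mulVf ?gt_eqF //.
by move=> /(_ (lexx _)); rewrite ler_pdivrMl // mulrC.
Qed.

Lemma cstar_mxnorm_le n (X : 'M[A]_n) c :
  (forall v : 'cV[A]_n, hilb_norm v <= 1 -> hilb_norm (X *m v) <= c) ->
  cstar_mxnorm X <= c.
Proof.
move=> h; apply: ge_sup; last by move=> _ [v /h + <-].
by exists (hilb_norm (X *m (0 : 'cV_n))), 0 => //=; rewrite hilb_norm0.
Qed.

Lemma rnorm_dot_mx_le n (X : 'M[A]_n) (v w : 'cV[A]_n) :
  rnorm (dot w (X *m v)) <= hilb_norm w * (cstar_mxnorm X * hilb_norm v).
Proof.
by rewrite (le_trans (rnorm_dot_le _ _)) // ler_wpM2l ?hilb_norm_ge0 ?cstar_mxnorm_ub.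
Qed.

Lemma hilb_norm1 (v : 'cV[A]_1) : hilb_norm v = rnorm (v 0 0).
Proof.
apply/eqP; rewrite -(@eqrXn2 _ 2) ?hilb_norm_ge0 ?rnorm_ge0 //.
by rewrite sqr_hilb_norm /dot big_ord1 rnorm_starM.
Qed.

Lemma cstar_mxnorm1 (X : 'M[A]_1) : cstar_mxnorm X = rnorm (X 0 0).
Proof.
apply/le_anti/andP; split.
  apply: cstar_mxnorm_le => v; rewrite !hilb_norm1 mxE big_ord1 => v1.
  by rewrite (le_trans (rnormM _ _)) // -[leRHS]mulr1 ler_wpM2l ?rnorm_ge0.
have := @cstar_mxnorm_ub1 _ X (\col__ 1); rewrite !hilb_norm1 !mxE big_ord1 mxE.
by rewrite mulr1; apply; exact: rnorm1_le.
Qed.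

Lemma cc_rnorm (f : A -> A) x : completely_contractive f -> rnorm (f x) <= rnorm x.
Proof. by move=> /(_ 1 (const_mx x)); rewrite !cstar_mxnorm1 !mxE. Qed.

Lemma adjmxM m n p (Y : 'M[A]_(m, n)) (Z : 'M[A]_(n, p)) :
  adjmx (Y *m Z) = adjmx Z *m adjmx Y.
Proof.
apply/matrixP => i j; rewrite !mxE star_sum; apply: eq_bigr => k _.
by rewrite !mxE starMr.
Qed.

Lemma mx_ge0_psq n (X : 'M[A]_n) (v : 'cV[A]_n) : mx_ge0 X -> psq (dot v (X *m v)).
Proof.
move=> [Y ->]; suff -> : dot v (adjmx Y *m Y *m v) = dot (Y *m v) (Y *m v).
  exact: psq_dot.
by rewrite -!dotE adjmxM !mulmxA.
Qed.

End HilbertModule.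

(** * Limits of bounded scalar sequences along an ultrafilter *)

Section UltraLimit.
Variables (R : realType) (U : set_system nat).
Hypothesis U_ultra : UltraFilter U.
#[local] Existing Instance U_ultra.
#[local] Instance ultra_proper_instance : ProperFilter U := ultra_proper.
Implicit Types (z w : nat -> R[i]^o).

Lemma ultra_fmap (T : Type) (u : nat -> T) : UltraFilter (u @ U).
Proof.
split; first exact: fmap_proper_filter.
move=> G G_proper UG; rewrite predeqE => B; split=> [GB|]; last exact: UG.
have [//|h] := in_ultra_setVsetC (u @^-1` B) U_ultra.
have GC : G (~` B) by exact: UG.
by have /filter_ex[x [Bx /(_ Bx)]] : G (B `&` ~` B) by exact: filterI.
Qed.

Lemma ultra_cvg_real (u : nat -> R) c :
  (forall n, `|u n| <= c) -> exists l : R, u @ U --> l.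
Proof.
move=> uc; have := @segment_compact R (- c) c; rewrite compact_ultra.
move=> /(_ _ (ultra_fmap u))[|l [_ ul]]; last by exists l.
by apply: (@filterE _ U) => n; rewrite /= in_itv /= -ler_norml uc.
Qed.

Lemma rnorm_le_ReIm (z : R[i]^o) : rnorm z <= `|complex.Re z| + `|complex.Im z|.
Proof.
have E t : rnorm (t%:C : R[i]^o) = `|t| := Re_normc_real t.
rewrite {1}[z]complexE (le_trans (@rnormD R R[i]^o _ _)) // E lerD2l.
rewrite [rnorm _](@rnormZ R R[i]^o 'i (complex.Im z)%:C) E normc_def /=.
by rewrite expr0n expr1n add0r sqrtr1 mul1r.
Qed.

Lemma Re_le_rnorm (z : R[i]^o) : `|complex.Re z| <= rnorm z.
Proof. by rewrite -lecR -(rnormE z); exact: normc_ge_Re. Qed.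

Lemma Im_le_rnorm (z : R[i]^o) : `|complex.Im z| <= rnorm z.
Proof.
rewrite -lecR -rnormE normc_def lecR -[`|_|]sqrtr_sqr ler_wsqrtr //.
by rewrite lerDr sqr_ge0.
Qed.

Lemma complex_cvg_rnorm (T : Type) (F : set_system T) {FF : Filter F}
    (V : normedModType R[i]) (f : T -> V) l :
  (forall e : R, 0 < e -> \forall x \near F, rnorm (l - f x) <= e) -> f @ F --> l.
Proof.
move=> h; apply/cvgrPdist_le => e; rewrite ltcE => /andP[/eqP /= e0 e1].
rewrite [e]complexE e0 mulr0 addr0.
by apply: filterS (h _ e1) => x; rewrite rnormE lecR.
Qed.

Lemma complex_cvg_rnorm_lim (T : Type) (F : set_system T) {FF : Filter F}
    (V : normedModType R[i]) (f : T -> V) l (e : R) :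
  f @ F --> l -> 0 < e -> \forall x \near F, rnorm (l - f x) <= e.
Proof.
move=> /cvgrPdist_le /(_ e%:C); rewrite ltcR => h /h.
by apply: filterS => x; rewrite rnormE lecR.
Qed.

Lemma ultra_cvg z (c : R) : (forall n, rnorm (z n) <= c) ->
  exists l : R[i]^o, z @ U --> l.
Proof.
move=> zc.
have [a ua] := ultra_cvg_real (fun n => le_trans (Re_le_rnorm (z n)) (zc n)).
have [b ub] := ultra_cvg_real (fun n => le_trans (Im_le_rnorm (z n)) (zc n)).
exists (a +i* b); apply: complex_cvg_rnorm => e e0.
have e20 : 0 < e / 2 by rewrite divr_gt0.
move/cvgrPdist_le/(_ _ e20) : ua => ua; move/cvgrPdist_le/(_ _ e20) : ub => ub.
apply: filterS2 ua ub => n ua ub; apply: le_trans (rnorm_le_ReIm _) _.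
by rewrite [e]splitr; case: (z n) ua ub => x y /= ? ?; apply: lerD.
Qed.

Definition ulim z : R[i]^o := lim (z @ U).

Lemma ulimP z c : (forall n, rnorm (z n) <= c) -> z @ U --> ulim z.
Proof. by move=> /ultra_cvg[l zl]; apply: cvgP zl. Qed.

Lemma ulim_eq z l : z @ U --> l -> ulim z = l.
Proof. by move=> zl; apply: cvg_lim => //; exact: norm_hausdorff. Qed.

Lemma ulim_le z c : (forall n, rnorm (z n) <= c) -> rnorm (ulim z) <= c.
Proof.
move=> zc; have zl := ulimP zc; apply/ler_addgt0Pr => e e0.
have [n h] := filter_ex (complex_cvg_rnorm_lim zl e0).
rewrite -[ulim z](subrK (z n)) (le_trans (rnormD _ _)) // addrC.
exact: lerD.
Qed.

End UltraLimit.

Section OperatorNorm.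
Variables (R : realType) (V W : normedModType R[i]).

Lemma linear_rnorm_bound (f : {linear V -> W}) : continuous f ->
  exists2 c : R, 0 <= c & forall x, rnorm (f x) <= c * rnorm x.
Proof.
move=> /linear_bounded_continuous/linear_boundedP h.
have /filter_ex[c [c0 hc]] : \forall c \near +oo, 0 < c /\ forall x, `|f x| <= c * `|x|.
  by apply: filterI => //; exact: nbhs_pinfty_gt.
move: c0; rewrite ltcE => /andP[/eqP /= c0 c1].
exists (complex.Re c); first exact: ltW.
move=> x; rewrite -lecR rmorphM /= -!rnormE (le_trans (hc x)) //.
by rewrite [c in leLHS]complexE c0 mulr0 addr0.
Qed.

Lemma rnorm_le_opnorm (f : {linear V -> W}) x : continuous f ->
  rnorm (f x) <= opnorm f * rnorm x.
Proof.
move=> /linear_rnorm_bound[c c0 fc].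
have [->|/eqP x0] := eqVneq x 0; first by rewrite linear0 !rnorm0 mulr0.
have n0 : 0 < rnorm x.
  by rewrite lt_neqAle rnorm_ge0 andbT; apply/eqP => /esym/rnorm_eq0.
have : rnorm (f ((rnorm x)^-1%:C *: x)) <= opnorm f.
  apply: ub_le_sup.
    exists c => _ [y /= y1 <-]; apply: le_trans (fc y) _.
    by rewrite -[leRHS]mulr1 ler_wpM2l.
  exists ((rnorm x)^-1%:C *: x) => //=.
  by rewrite rnormZR ger0_norm ?invr_ge0 ?rnorm_ge0 // mulVf ?gt_eqF.
rewrite linearZ rnormZR ger0_norm ?invr_ge0 ?rnorm_ge0 //.
by rewrite ler_pdivrMl // mulrC.
Qed.

Lemma opnorm_le (f : {linear V -> W}) c : 0 <= c ->
  (forall x, rnorm (f x) <= c * rnorm x) -> opnorm f <= c.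
Proof.
move=> c0 fc; apply: ge_sup.
  by exists (rnorm (f 0)), 0 => //=; rewrite rnorm0.
by move=> _ [x /= x1 <-]; apply: le_trans (fc x) _; rewrite -[leRHS]mulr1 ler_wpM2l.
Qed.

Lemma bounded_continuous (f : {linear V -> W}) (c : R) :
  (forall x, rnorm (f x) <= c * rnorm x) -> continuous f.
Proof.
move=> fc; apply/linear_bounded_continuous/linear_boundedP.
have c_real : c%:C \is Num.real by rewrite complex_real.
apply: filterS (nbhs_pinfty_ge c_real) => r cr x.
by rewrite (le_trans _ (ler_wpM2r (normr_ge0 x) cr)) // !rnormE -rmorphM lecR.
Qed.

End OperatorNorm.

(** * Weak* limits of sequences in A *)

Section WeakStarLimit.
Variables (R : realType) (A : cstarAlgType R) (D : predual A) (U : set_system nat).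
Hypotheses (U_ultra : UltraFilter U) (U_free : \oo `<=` U).
#[local] Existing Instance U_ultra.
#[local] Instance ultra_proper_weakstar : ProperFilter U := ultra_proper.
Implicit Types (x y : nat -> A) (a b : A).

Let X := predual_space D.
Let pair := @predual_pair R A D.

Lemma pairD a b (xi : X) : pair (a + b) xi = pair a xi + pair b xi.
Proof. by have := predual_pair_linear 1 a b xi; rewrite scale1r mul1r. Qed.

Lemma pair0 (xi : X) : pair 0 xi = 0.
Proof. by apply: (addIr (pair 0 xi)); rewrite -pairD !add0r. Qed.

Lemma pairZ (c : R[i]) a (xi : X) : pair (c *: a) xi = c * pair a xi.
Proof. by have := predual_pair_linear c a 0 xi; rewrite addr0 -/pair pair0 addr0. Qed.

Lemma pairN a (xi : X) : pair (- a) xi = - pair a xi.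
Proof. by rewrite -scaleN1r pairZ mulN1r. Qed.

Lemma rnorm_pair_le a (xi : X) : rnorm (pair a xi) <= rnorm a * rnorm xi.
Proof.
rewrite -(predual_pair_isometry D a); apply: rnorm_le_opnorm.
exact: predual_pair_continuous.
Qed.

Lemma rnorm_le_pair a c : 0 <= c ->
  (forall xi : X, rnorm (pair a xi) <= c * rnorm xi) -> rnorm a <= c.
Proof.
move=> c0 h; rewrite -(predual_pair_isometry D a); exact: opnorm_le.
Qed.

Definition wcvg x a := forall xi : X, (fun n => pair (x n) xi : R[i]^o) @ U --> pair a xi.

Lemma wcvg_le x a c : wcvg x a -> (forall n, rnorm (x n) <= c) -> rnorm a <= c.
Proof.
move=> xa xc; have c0 := le_trans (rnorm_ge0 _) (xc 0).
apply: rnorm_le_pair => // xi; rewrite -(ulim_eq U_ultra (xa xi)).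
apply: (@ulim_le _ U) => n; apply: le_trans (rnorm_pair_le _ _) _.
by rewrite ler_wpM2r ?rnorm_ge0.
Qed.

Lemma wcvgD x y a b : wcvg x a -> wcvg y b -> wcvg (fun n => x n + y n) (a + b).
Proof.
move=> xa yb xi; rewrite pairD; under eq_fun do rewrite pairD.
exact: (cvgD (xa xi) (yb xi)).
Qed.

Lemma wcvgZ (c : R[i]) x a : wcvg x a -> wcvg (fun n => c *: x n) (c *: a).
Proof.
move=> xa xi; rewrite pairZ; under eq_fun do rewrite pairZ.
exact: (cvgZl_tmp (k := c) (xa xi)).
Qed.

Lemma wcvg_cst a : wcvg (fun=> a) a.
Proof. by move=> xi; exact: cvg_cst. Qed.

Lemma wcvg_unique x a b : wcvg x a -> wcvg x b -> a = b.
Proof.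
move=> xa xb; apply/subr0_eq/rnorm_eq0/le_anti; rewrite rnorm_ge0 andbT.
apply: rnorm_le_pair => // xi; rewrite pairD pairN.
rewrite -(ulim_eq U_ultra (xa xi)) -(ulim_eq U_ultra (xb xi)) subrr.
by rewrite rnorm0 mul0r.
Qed.

Lemma wcvg_null x : rcvg x 0 -> wcvg x 0.
Proof.
move=> x0 xi; rewrite pair0; apply: complex_cvg_rnorm => e e0.
have d0 : 0 < rnorm xi + 1 by rewrite ltr_wpDl ?rnorm_ge0.
have [n0 h] := x0 (e / (rnorm xi + 1)) (divr_gt0 e0 d0).
apply: U_free; exists n0 => // n /h; rewrite subr0 sub0r rnormN => h'.
apply: le_trans (rnorm_pair_le _ _) _.
rewrite (le_trans (ler_wpM2r (rnorm_ge0 _) h')) // mulrAC ler_pdivrMr //.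
by rewrite ler_wpM2l ?ltW // ltrDl.
Qed.

(** Banach-Alaoglu along [U]: the pointwise limit of the functionals is linear and bounded by [c],
    hence comes from an element of [A] by [predual_pair_onto]. *)
Lemma wcvg_ex x c : (forall n, rnorm (x n) <= c) -> exists a, wcvg x a.
Proof.
move=> xc; have c0 := le_trans (rnorm_ge0 _) (xc 0).
have pb xi n : rnorm (pair (x n) xi) <= c * rnorm xi.
  by rewrite (le_trans (rnorm_pair_le _ _)) // ler_wpM2r ?rnorm_ge0.
pose f (xi : X) : R[i]^o := ulim U (fun n => pair (x n) xi).
have fP xi : (fun n => pair (x n) xi : R[i]^o) @ U --> f xi.
  exact: ulimP (pb xi).
have f_lin : linear f.
  move=> k xi eta; apply: ulim_eq; under eq_fun do rewrite linearP.
  exact: cvgD (cvgZl_tmp (k := k) (fP xi)) (fP eta).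
pose g : {linear X -> R[i]^o} := HB.pack f (GRing.isLinear.Build _ _ _ _ _ f_lin).
have g_cont : continuous g.
  apply: (@bounded_continuous _ _ _ _ c) => xi.
  exact: (@ulim_le _ U).
have [a aP] := predual_pair_onto g_cont.
by exists a => xi; rewrite /pair aP; exact: fP.
Qed.

(** Links convergence of the pairings, used in all estimates, with the topology in which
    weak*-continuity of a map is stated. *)
Lemma wcvgP x a : wcvg x a <-> (x @ U --> (a : weakstar D)).
Proof.
pose h : A -> {ptws X -> R[i]^o} := fun a => pair a.
split=> [xa B [C [[V Vopen <-] Va VB]]|xa xi].
  have : (h \o x) @ U --> h a by apply/pointwise_cvgP => xi; exact: xa.
  have hV : nbhs (h a) V by exact: open_nbhs_nbhs.
  move=> /(_ V hV) hx; have UV : U (x @^-1` (h @^-1` V)) by exact: hx.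
  have UB : U (x @^-1` B) by apply: filterS UV => n /VB.
  exact: UB.
have /continuous_cvg : {for (a : weakstar D), continuous (h : weakstar D -> _)}.
  exact: initial_continuous.
by move=> /(_ _ _ _ x xa) /pointwise_cvgP /(_ xi).
Qed.

Lemma wcvg_map (f : A -> A) x a :
  weakstar_continuous D f -> wcvg x a -> wcvg (f \o x) (f a).
Proof.
move=> f_cont /wcvgP xa; apply/wcvgP.
exact: (cvg_comp _ _ xa (f_cont a)).
Qed.

End WeakStarLimit.

(** * Inequalities between commuting elements *)

Section CommutingInequalities.
Variables (R : realType) (A : cstarAlgType R).
Implicit Types (c g h x y z v : A).

(** [C] and [S] rotate the pair (y, z) into (C y - S z, S y + C z), which preserves the sum of the
    two squares; dropping the first component only decreases it. *)
Lemma rnorm_rotation_le (C S y z : A) : selfadj C -> selfadj S -> C * S = S * C ->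
  C * C + S * S = 1 -> rnorm (S * y + C * z) ^+ 2 <= rnorm y ^+ 2 + rnorm z ^+ 2.
Proof.
move=> sC sS CS CS1; rewrite -!rnorm_starM.
apply: le_trans (rnormD _ _); apply: psq_rnorm_le; first exact: psq_starM.
rewrite starD !starMr sC sS.
have -> : star y * y + star z * z -
    (star y * S + star z * C) * (S * y + C * z) =
    star (C * y - S * z) * (C * y - S * z).
  rewrite -{1}[star y]mulr1 -{1}[star z]mulr1 -CS1 starB !starMr sC sS.
  have -> : star y * (C * C + S * S) * y + star z * (C * C + S * S) * z -
    (star y * S + star z * C) * (S * y + C * z) =
    (star y * C - star z * S) * (C * y - S * z) +
    star y * (C * S - S * C) * z - star z * (C * S - S * C) * y by ncring.
  by rewrite CS subrr !(mulr0, mul0r) subr0 addr0.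
exact: psq_starM.
Qed.

(** The difference of the squares is [star v * ((h - g) * (h + g)) * v], and a product of commuting
    positive elements is positive. *)
Lemma rnorm_comm_le g h v : psq g -> psq (h - g) -> g * h = h * g ->
  rnorm (g * v) <= rnorm (h * v).
Proof.
move=> pg phg gh; have ph : psq h by rewrite -[h](subrK g); exact: psqD.
rewrite -ler_sqr ?nnegrE ?rnorm_ge0 // -!rnorm_starM.
apply: psq_rnorm_le; first exact: psq_starM.
have -> : star (h * v) * (h * v) - star (g * v) * (g * v) =
    star v * ((h - g) * (h + g)) * v.
  rewrite !starMr (psq_selfadj ph) (psq_selfadj pg).
  have -> : star v * h * (h * v) - star v * g * (g * v) =
    star v * ((h - g) * (h + g)) * v + star v * (g * h - h * g) * v by ncring.
  by rewrite gh subrr mulr0 mul0r addr0.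
apply/psq_conj/psq_comm_mul => //; first exact: psqD.
have -> : (h - g) * (h + g) = (h + g) * (h - g) + 2%:C *: (h * g - g * h) by ncring.
by rewrite gh subrr scaler0 addr0.
Qed.

Lemma commrXX c m n : c ^+ m * c ^+ n = c ^+ n * c ^+ m.
Proof. by rewrite -!exprD addnC. Qed.

Lemma psqX c n : psq c -> psq (c ^+ n).
Proof.
move=> pc; elim: n => [|n IH]; first exact: psq1.
by rewrite exprS; apply: psq_comm_mul => //; rewrite -[c]expr1 -exprM mul1n commrXX.
Qed.

Lemma comm1BX c m : (1 - c) * c ^+ m = c ^+ m * (1 - c).
Proof. by rewrite mulrBl mulrBr mul1r mulr1 -exprS -exprSr. Qed.

Lemma psq_1BX c n : psq c -> psq (1 - c) -> psq (1 - c ^+ n).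
Proof.
move=> pc p1c; elim: n => [|n IH]; first by rewrite subrr; exact: psq0.
have -> : 1 - c ^+ n.+1 = (1 - c ^+ n) + (1 - c) * c ^+ n.
  by rewrite exprS mulrBl mul1r addrA subrK.
by apply: psqD => //; apply: psq_comm_mul; [|exact: psqX|exact: comm1BX].
Qed.

(* In the commutative algebra generated by c this reads
   (m+1) (1-c) c^m <= (1-c) (1 + c + ... + c^m) <= 1. *)
Lemma psq_1B_mul_1BX c m : psq c -> psq (1 - c) ->
  psq (1 - m.+1%:R%:C *: ((1 - c) * c ^+ m)).
Proof.
move=> pc p1c.
suff h : psq (1 - c ^+ m - m%:R%:C *: ((1 - c) * c ^+ m)).
  have -> : 1 - m.+1%:R%:C *: ((1 - c) * c ^+ m) =
      (1 - c ^+ m - m%:R%:C *: ((1 - c) * c ^+ m)) + c ^+ m.+1.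
    rewrite -natr1 rmorphD /= exprSr; move: (c ^+ m) (comm1BX c m) => d E.
    rewrite E.
    have -> : 1 - (m%:R%:C + 1) *: (d * (1 - c)) =
      1 - d - m%:R%:C *: (d * (1 - c)) + d * c by ncring.
    by [].
  by apply: psqD => //; exact: psqX.
elim: m => [|m IH]; first by rewrite subrr scale0r subr0; exact: psq0.
have -> : 1 - c ^+ m.+1 - m.+1%:R%:C *: ((1 - c) * c ^+ m.+1) =
   (1 - c ^+ m - m%:R%:C *: ((1 - c) * c ^+ m)) +
   m.+1%:R%:C *: ((1 - c) * ((1 - c) * c ^+ m)).
  by rewrite -natr1 rmorphD /= exprS; move: (c ^+ m) => d; ncring.
apply: psqD => //; apply: psqZ; first exact: ler0n.
have p : psq ((1 - c) * c ^+ m).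
  by apply: psq_comm_mul; [|exact: psqX|exact: comm1BX].
by apply: psq_comm_mul => //; rewrite -mulrA -comm1BX.
Qed.

End CommutingInequalities.

(** * Central binomial coefficients and roots of unity *)

Lemma central_bin_rec k : (k.+1 * 'C(k.+1.*2, k.+1) = 2 * (k.*2.+1 * 'C(k.*2, k)))%N.
Proof.
apply/eqP; rewrite -(eqn_pmul2l (ltn0Sn k)); apply/eqP.
have h1 : (k.+1.*2 * 'C(k.*2.+1, k) = k.+1 * 'C(k.+1.*2, k.+1))%N.
  by rewrite -mul_bin_diag.
have h2 : (k.*2.+1 * 'C(k.*2, k) = k.+1 * 'C(k.*2.+1, k.+1))%N.
  by rewrite -mul_bin_diag.
have h3 : 'C(k.*2.+1, k.+1) = 'C(k.*2.+1, k).
  by rewrite -bin_sub ?ltnS -?addnn ?leq_addr // subSS addnK.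
rewrite h3 in h2; rewrite -h1 h2 -mul2n.
by lia.
Qed.

(** The bound 4^k / sqrt (4k+1), squared to stay in [nat]. The factor 4k+1 is tuned to the
    induction, whose step amounts to (2k+1)^2 (4k+5) >= 4 (4k+1) (k+1)^2: the two sides differ by
    1. *)
Lemma central_bin_ge k : (16 ^ k <= 'C(k.*2, k) ^ 2 * (4 * k).+1)%N.
Proof.
elim: k => [|k IH] //; have := central_bin_rec k.
move: 'C(k.+1.*2, _) 'C(k.*2, k) IH => a b IH E.
rewrite expnS; have h : (16 * 16 ^ k * k.+1 ^ 2 <= a ^ 2 * (4 * k.+1).+1 * k.+1 ^ 2)%N.
  have -> : (a ^ 2 * (4 * k.+1).+1 * k.+1 ^ 2 = (k.+1 * a) ^ 2 * (4 * k.+1).+1)%N by lia.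
  rewrite E; move: (16 ^ k)%N IH => p IH.
  have : (16 * (b ^ 2 * (4 * k).+1) * k.+1 ^ 2 <=
     (2 * (k.*2.+1 * b)) ^ 2 * (4 * k.+1).+1)%N.
    have -> : (16 * (b ^ 2 * (4 * k).+1) * k.+1 ^ 2 =
      b ^ 2 * (16 * (4 * k).+1 * k.+1 ^ 2))%N by lia.
    have -> : ((2 * (k.*2.+1 * b)) ^ 2 * (4 * k.+1).+1 =
      b ^ 2 * (4 * k.*2.+1 ^ 2 * (4 * k.+1).+1))%N by lia.
    by rewrite leq_mul2l; apply/orP; right; rewrite -muln2; nia.
  by nia.
by rewrite -(leq_pmul2r (m := k.+1 ^ 2)).
Qed.

Section RootsOfUnity.
Variable R : realType.
Implicit Types (z r : R[i]).

(** ['X^n - 1] splits over [R[i]] and is separable, and n distinct n-th roots of unity in a field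
    include a primitive one. *)
Lemma complex_prim_root n : (0 < n)%N -> exists z : R[i], n.-primitive_root z.
Proof.
pose p : {poly R[i]} := 'X^n - 1; have [r Dp] := closed_field_poly_normal p.
move=> n_gt0; rewrite (monicP _) ?monicXnsubC // scale1r in Dp.
have rn1: all n.-unity_root r by apply/allP => z; rewrite -root_prod_XsubC -Dp.
have sz_r: (n < (size r).+1)%N.
  by rewrite -(size_prod_XsubC r id) -Dp size_XnsubC.
have [|z] := hasP (cyclic.has_prim_root n_gt0 rn1 _ sz_r); last by exists z.
rewrite -separable.separable_prod_XsubC -Dp.
by rewrite cyclotomic.separable_Xn_sub_1 // pnatr_eq0 -lt0n.
Qed.

Lemma conjc_unity_root z n : z ^+ n.+1 = 1 -> z * conjc z = 1.
Proof.
move=> zn; rewrite -sqr_normc; have : `|z| ^+ n.+1 = 1 by rewrite -normrX zn normr1.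
by move=> /eqP; rewrite pexpr_eq1 // => /eqP ->; rewrite expr1n.
Qed.

Lemma sum_unity_root r n : r ^+ n = 1 -> r != 1 -> \sum_(j < n) r ^+ j = 0.
Proof.
move=> rn r1; have := subrX1 r n; rewrite rn subrr => /esym/eqP.
by rewrite mulf_eq0 subr_eq0 (negbTE r1) => /eqP.
Qed.

End RootsOfUnity.

(** * Cosines of a unitary *)

Section UnitaryCosine.
Variables (R : realType) (A : cstarAlgType R) (w : A).
Hypotheses (ww : star w * w = 1) (ww' : w * star w = 1).
Implicit Types (zeta : R[i]) (v z : A).

(* Re (conj zeta * w) and Im (conj zeta * w) *)
Definition ucos zeta : A := 2^-1%:C *: (conjc zeta *: w + zeta *: star w).
Definition usin zeta : A :=
  (2^-1%:C * - 'i) *: (conjc zeta *: w - zeta *: star w).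

Lemma selfadj_ucos zeta : selfadj (ucos zeta).
Proof. by rewrite /selfadj starZR starD !starZc starK conjcK addrC. Qed.

Lemma selfadj_usin zeta : selfadj (usin zeta).
Proof.
rewrite /selfadj starZc starB !starZc starK conjcK -opprB scalerN -scaleNr.
by congr (_ *: _); apply/eqP; rewrite eq_complex /=; apply/andP; split; apply/eqP; ring.
Qed.

Lemma ucos_usinC zeta : ucos zeta * usin zeta = usin zeta * ucos zeta.
Proof.
apply/subr0_eq; rewrite /ucos /usin; move: (2^-1%:C * - 'i) (conjc zeta) => k eta.
have -> : 2^-1%:C *: (eta *: w + zeta *: star w) * (k *: (eta *: w - zeta *: star w)) -
  k *: (eta *: w - zeta *: star w) * (2^-1%:C *: (eta *: w + zeta *: star w)) =
  (k * eta * zeta) *: (star w * w - w * star w) by ncring.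
by rewrite ww ww' subrr scaler0.
Qed.

Lemma ucos2_usin2 zeta : zeta * conjc zeta = 1 ->
  ucos zeta * ucos zeta + usin zeta * usin zeta = 1.
Proof.
move=> z1; have i2 : (2^-1%:C * - 'i) * (2^-1%:C * - 'i) = - (2^-1%:C * 2^-1%:C) :> R[i].
  by rewrite mulrACA mulrNN -(expr2 'i) sqr_i mulrN1.
rewrite /ucos /usin; move: (2^-1%:C * - 'i) (conjc zeta) i2 z1 => k eta i2 z1.
have -> : 2^-1%:C *: (eta *: w + zeta *: star w) * (2^-1%:C *: (eta *: w + zeta *: star w)) +
  k *: (eta *: w - zeta *: star w) * (k *: (eta *: w - zeta *: star w)) =
  (2^-1%:C * 2^-1%:C) *: ((eta *: w + zeta *: star w) * (eta *: w + zeta *: star w)) +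
  (k * k) *: ((eta *: w - zeta *: star w) * (eta *: w - zeta *: star w)) by ncring.
rewrite i2.
have -> : (2^-1%:C * 2^-1%:C) *: ((eta *: w + zeta *: star w) * (eta *: w + zeta *: star w)) +
  (- (2^-1%:C * 2^-1%:C)) *: ((eta *: w - zeta *: star w) * (eta *: w - zeta *: star w)) =
  (2^-1%:C * (zeta * eta)) *: (w * star w + star w * w) by ncring.
by rewrite ww ww' z1; ncring.
Qed.

Lemma scaleAX (k : R[i]) (x : A) n : (k *: x) ^+ n = k ^+ n *: x ^+ n.
Proof.
elim: n => [|n IH]; first by rewrite !expr0 scale1r.
by rewrite !exprS IH scaleAl scaleAr scalerA.
Qed.

Lemma unitaryX n : w ^+ n * star w ^+ n = 1.
Proof.
elim: n => [|n IH]; first by rewrite mulr1.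
by rewrite exprSr exprS mulrA -(mulrA _ w) ww' mulr1.
Qed.

Lemma ucosX zeta n : ucos zeta ^+ n = (2^-1%:C ^+ n) *:
  \sum_(i < n.+1) (conjc zeta ^+ (n - i) * zeta ^+ i) *: (w ^+ (n - i) * star w ^+ i) *+ 'C(n, i).
Proof.
rewrite scaleAX exprDn_comm; last first.
  by rewrite /GRing.comm !scaleAl !scaleAr !scalerA ww ww' mulrC.
congr (_ *: _); apply: eq_bigr => i _; rewrite !scaleAX scaleAl scaleAr scalerA.
by [].
Qed.

(** In the binomial expansion the term of index i carries a geometric sum of ratio zeta^i /
    zeta^(4m-i). Both exponents lie below the order 4m+1, so the ratio is 1 only for i = 2m, where
    the powers of [w] and [star w] cancel. *)
Lemma sum_ucosX zeta m : (4 * m).+1.-primitive_root zeta ->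
  \sum_(j < (4 * m).+1) ucos (zeta ^+ j) ^+ (4 * m) =
  ((4 * m).+1%:R * 'C(4 * m, 2 * m)%:R / 16 ^+ m)%:C *: (1 : A).
Proof.
move=> zP; have z1 := prim_expr_order zP; have zz := conjc_unity_root z1.
have z0 : zeta != 0 by rewrite (prim_root_eq0 zP).
have zE : conjc zeta = zeta^-1.
  by apply: (mulfI z0); rewrite zz mulfV.
under eq_bigr do rewrite ucosX.
rewrite -scaler_sumr exchange_big /=.
have lt2m : (2 * m < (4 * m).+1)%N by lia.
rewrite (bigD1 (Ordinal lt2m)) //= [X in _ + X]big1 ?addr0 => [|i i2m]; last first.
  rewrite sumrMnl -scaler_suml.
  rewrite (_ : \sum_(j < _) _ = 0) ?scale0r ?mul0rn //.
  pose r := zeta^-1 ^+ (4 * m - i) * zeta ^+ i.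
  rewrite (eq_bigr (fun j : 'I_(4 * m).+1 => r ^+ j)) => [|j _]; last first.
    by rewrite rmorphXn /= zE exprMn -!exprM ![(j * _)%N]mulnC.
  apply: sum_unity_root.
    by rewrite exprMn -!exprM ![(_ * (4 * m).+1)%N]mulnC !exprM exprVn z1 invr1 !expr1n mulr1.
  apply: contraNneq i2m => rE.
  have : zeta ^+ i == zeta ^+ (4 * m - i).
    rewrite -[X in X == _]mul1r -(mulVf (expf_neq0 (4 * m - i) z0)) -mulrA mulrCA.
    by rewrite -exprVn -/r rE mulr1.
  rewrite (eq_prim_root_expr zP) !modn_small; try by have := ltn_ord i; lia.
  by move=> /eqP h; apply/eqP/val_inj => /=; have := ltn_ord i; lia.
have -> : (4 * m - 2 * m = 2 * m)%N by lia.
rewrite (eq_bigr (fun=> (1 : A) *+ 'C(4 * m, 2 * m))) => [|j _]; last first.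
  rewrite unitaryX -exprMn rmorphXn /= -exprMn zE mulVf //.
  by rewrite !expr1n scale1r.
rewrite sumr_const card_ord -mulrnA.
set k := ('C(_, _) * _)%N.
have -> : (1 : A) *+ k = k%:R%:C *: (1 : A) by rewrite rmorph_nat scaler_nat.
rewrite scalerA; congr (_ *: _); rewrite -rmorphXn -rmorphM /=; congr (_%:C).
rewrite /k natrM mulrC [_ * (4 * m).+1%:R]mulrC; congr (_ * _).
by rewrite exprVn exprM; congr ((_ ^+ _)^-1); ring.
Qed.

End UnitaryCosine.

(** * Vanishing of limits twisted by a unitary *)

Section Bimodule.
Variables (R : realType) (A : cstarAlgType R) (D : predual A) (U : set_system nat).
Hypotheses (U_ultra : UltraFilter U).
Implicit Types (x y : nat -> A) (a b v w z : A) (zeta : R[i]).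
Notation wcvg := (wcvg D U).

(** In the sine [S] the part with [star w] disappears in the limit, so [S * y n] tends to [k *: v]
    with |k| = 1/2. The rotation bound for [y n] and [k *: z] passes to the limit, and division by
    |k|^2 gives the factor 4. *)
Lemma wcvg_ucos_bound w y K v zeta z :
  star w * w = 1 -> w * star w = 1 -> zeta * conjc zeta = 1 ->
  (forall n, rnorm (y n) <= K) ->
  wcvg (fun n => star w * y n) 0 -> wcvg (fun n => w * y n) v ->
  rnorm (v + ucos w zeta * z) ^+ 2 <= 4 * K ^+ 2 + rnorm z ^+ 2.
Proof.
move=> ww ww' zz yK y0 yv; set C := ucos w zeta; set S := usin w zeta.
pose k : R[i] := (2^-1%:C * - 'i) * conjc zeta.
have k2 (u : A) : rnorm (k *: u) ^+ 2 = rnorm u ^+ 2 / 4 :> R.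
  rewrite rnormZ exprMn mulrC; congr (_ * _); apply: complexI.
  rewrite rmorphXn [LHS](_ : _ = `|k| ^+ 2) // sqr_normc /k.
  rewrite rmorphM /= conjcK mulrACA [_ * zeta]mulrC zz mulr1.
  by apply/eqP; rewrite eq_complex /=; apply/andP; split; apply/eqP; field.
have K0 : 0 <= K ^+ 2 + rnorm (k *: z) ^+ 2 by rewrite addr_ge0 ?sqr_ge0.
have cvg_lim : wcvg (fun n => S * y n + C * (k *: z)) (k *: (v + C * z)).
  have -> : k *: (v + C * z) =
      (2^-1%:C * - 'i) *: (conjc zeta *: v + (- zeta) *: 0) + C * (k *: z).
    by rewrite scaler0 addr0 scalerA scaleAr -scalerDr.
  apply: wcvgD; last exact: wcvg_cst.
  have -> : (fun n => S * y n) = (fun n => (2^-1%:C * - 'i) *: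
      (conjc zeta *: (w * y n) + (- zeta) *: (star w * y n))).
    by apply/funext => n; rewrite /S /usin scaleAl mulrBl !scaleAl scaleNr.
  apply: wcvgZ; apply: wcvgD; [exact: (wcvgZ _ yv) | exact: (wcvgZ _ y0)].
have : rnorm (k *: (v + C * z)) <= Num.sqrt (K ^+ 2 + rnorm (k *: z) ^+ 2).
  apply: (wcvg_le U_ultra cvg_lim) => n.
  rewrite -[leLHS]ger0_norm ?rnorm_ge0 // -sqrtr_sqr ler_wsqrtr //.
  apply: le_trans (rnorm_rotation_le _ _ (selfadj_ucos _ _) (selfadj_usin _ _)
    (ucos_usinC ww ww' zeta) (ucos2_usin2 ww ww' zz)) _.
  by rewrite lerD2r ler_sqr ?nnegrE ?rnorm_ge0 // (le_trans (rnorm_ge0 _) (yK n)).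
rewrite -ler_sqr ?nnegrE ?rnorm_ge0 ?sqrtr_ge0 // sqr_sqrtr // !k2.
by lra.
Qed.

(* Apply the previous bound to z = t C^(2m+1) v with t = (m+1)/2. *)
Lemma wcvg_peak_bound w y K v zeta m :
  star w * w = 1 -> w * star w = 1 -> zeta * conjc zeta = 1 ->
  (forall n, rnorm (y n) <= K) ->
  wcvg (fun n => star w * y n) 0 -> wcvg (fun n => w * y n) v ->
  m.+1%:R * rnorm (ucos w zeta ^+ (2 * m) * v) ^+ 2 <= 8 * K ^+ 2.
Proof.
move=> ww ww' zz yK y0 yv; have bound := wcvg_ucos_bound _ ww ww' zz yK y0 yv.
set C := ucos w zeta in bound *; set S := usin w zeta.
have sC : selfadj C := selfadj_ucos w zeta.
have CS : C * C + S * S = 1 by exact: ucos2_usin2.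
pose c := C * C; have pc : psq c by exact: psq_sqr.
have p1c : psq (1 - c).
  by rewrite -CS /c addrC addKr; apply: psq_sqr; exact: selfadj_usin.
have NC : rnorm C <= 1.
  rewrite -(@expr_le1 _ 2) ?rnorm_ge0 // -rnorm_sqr //.
  by apply: (psq_le_rnorm pc p1c); exact: rnorm1_le.
rewrite exprM expr2 -/c; set e := c ^+ m.
have pe : psq e by exact: psqX.
pose t : R := m.+1%:R / 2; have t0 : 0 <= t by rewrite divr_ge0.
(* [h * v] is the element v + C z to be bounded, and [h] dominates (t + 1/2) e. Hence (t + 1/2)^2 |e
   v|^2 <= 4 K^2 + t^2 |e v|^2; the terms in t^2 cancel and t |e v|^2 <= 4 K^2 is left. *)
pose h := 1 + t%:C *: (c * e).
have p1 := psq_1B_mul_1BX m pc p1c; have p2 := psq_1BX m pc p1c.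
have hE : h - (t + 2^-1)%:C *: e =
    2^-1%:C *: (1 - m.+1%:R%:C *: ((1 - c) * c ^+ m)) + 2^-1%:C *: (1 - c ^+ m).
  have -> : m.+1%:R = 2 * t by rewrite /t; lra.
  by rewrite /h -/e; ncring.
have ce : c * e = e * c by rewrite /e -exprSr exprS.
have : rnorm (((t + 2^-1)%:C *: e) * v) <= rnorm (h * v).
  apply: rnorm_comm_le.
  - by apply: psqZ => //; rewrite addr_ge0 // invr_ge0.
  - by rewrite hE; apply: psqD; apply: psqZ => //; rewrite invr_ge0.
  - rewrite /h mulrDl mulrDr mul1r mulr1 !scaleAl !scaleAr; congr (_ + _).
    by rewrite !scalerA mulrC mulrA -ce.
rewrite scaleAl rnormZR ger0_norm ?addr_ge0 ?invr_ge0 // => h1.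
have hv : h * v = v + C * (t%:C *: (C * (e * v))).
  by rewrite /h /c; ncring.
have := bound (t%:C *: (C * (e * v))); rewrite -hv => h2.
have h3 : rnorm (t%:C *: (C * (e * v))) <= t * rnorm (e * v).
  rewrite rnormZR ger0_norm // ler_wpM2l // (le_trans (rnormM _ _)) //.
  by rewrite -[leRHS]mul1r ler_wpM2r ?rnorm_ge0.
have -> : m.+1%:R = 2 * t by rewrite /t; lra.
have h4 : rnorm (t%:C *: (C * (e * v))) ^+ 2 <= (t * rnorm (e * v)) ^+ 2.
  by rewrite ler_sqr ?nnegrE ?mulr_ge0 ?rnorm_ge0.
have h5 : ((t + 2^-1) * rnorm (e * v)) ^+ 2 <= rnorm (h * v) ^+ 2.
  by rewrite ler_sqr ?nnegrE ?mulr_ge0 ?addr_ge0 ?rnorm_ge0 ?invr_ge0.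
have := le_trans h5 (le_trans h2 (lerD (lexx _) h4)).
clearbody t; move: (rnorm (e * v)) (K ^+ 2) => n k.
have -> : ((t + 2^-1) * n) ^+ 2 = (t * n) ^+ 2 + t * n ^+ 2 + n ^+ 2 / 4 by field.
by have := sqr_ge0 n; lra.
Qed.

(* The kernels C_j^(4m), one for each (4m+1)-th root of unity, add up to a
   scalar of order sqrt m, while each of them contributes at most O(1/m). *)
Lemma wcvg_unitary0 w y K v :
  star w * w = 1 -> w * star w = 1 ->
  (forall n, rnorm (y n) <= K) ->
  wcvg (fun n => star w * y n) 0 -> wcvg (fun n => w * y n) v -> v = 0.
Proof.
move=> ww ww' yK y0 yv; set q := rnorm v ^+ 2.
have q0 : 0 <= q by exact: sqr_ge0.
(* 512 is 8 * 8^2: the square of [bq] is multiplied by 8 (m+1), and [b2] eliminates [b]. *)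
have main m : m.+1%:R * q ^+ 2 <= 512 * K ^+ 2 ^+ 2.
  have [zeta zP] := @complex_prim_root R (4 * m).+1 isT.
  have z1 := conjc_unity_root (prim_expr_order zP).
  have zz j : (zeta ^+ j) * conjc (zeta ^+ j) = 1.
    by rewrite rmorphXn /= -exprMn z1 expr1n.
  set b : R := 'C(4 * m, 2 * m)%:R / 16 ^+ m.
  have b0 : 0 <= b by rewrite divr_ge0 ?exprn_ge0.
  have b2 : 1 <= b ^+ 2 * (8 * m.+1%:R).
    have := central_bin_ge (2 * m); rewrite -mul2n mulnA expnM -[(16 ^ 2)%N]/256%N.
    rewrite -(ler_nat R) natrM !natrX => h.
    rewrite /b expr_div_n mulrAC ler_pdivlMr ?exprn_gt0 // mul1r.
    rewrite -exprM mulnC exprM (_ : 16 ^+ 2 = 256); last by ring.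
    apply: le_trans h _; rewrite ler_wpM2l ?sqr_ge0 //.
    by rewrite -natrM ler_nat; lia.
  have bq : m.+1%:R * (b * q) <= 8 * K ^+ 2.
    have M0 : 0 < (4 * m).+1%:R :> R by rewrite ltr0n.
    rewrite -(ler_pM2l M0).
    have : (4 * m).+1%:R * b * q =
        rnorm (star v * (\sum_(j < (4 * m).+1) ucos w (zeta ^+ j) ^+ (4 * m)) * v).
      rewrite (sum_ucosX ww ww' zP) scaleAr scaleAl mulr1 rnormZR rnorm_starM.
      by rewrite ger0_norm ?mulrA // divr_ge0 ?mulr_ge0 ?exprn_ge0.
    rewrite mulr_sumr mulr_suml => E.
    (* The exponent 4m is twice 2m and the cosine is selfadjoint, so star v C^(4m) v is the square
       to which [wcvg_peak_bound] applies. *)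
    have {}E : (4 * m).+1%:R * b * q <=
        \sum_(j < (4 * m).+1) rnorm (ucos w (zeta ^+ j) ^+ (2 * m) * v) ^+ 2.
      rewrite E (le_trans (rnorm_sum _ _ _)) //; apply: ler_sum => j _.
      rewrite -rnorm_starM starMr starX (selfadj_ucos w (zeta ^+ j)).
      move: (ucos w _) => C; have -> : (4 * m = 2 * m + 2 * m)%N by lia.
      by rewrite exprD !mulrA.
    have -> : (4 * m).+1%:R * (m.+1%:R * (b * q)) = m.+1%:R * ((4 * m).+1%:R * b * q).
      by ring.
    apply: le_trans (ler_wpM2l _ E) _; first exact: ler0n.
    rewrite mulr_sumr; apply: (@le_trans _ _ (\sum_(j < (4 * m).+1) 8 * K ^+ 2)).
      by apply: ler_sum => j _; exact: wcvg_peak_bound.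
    by rewrite sumr_const card_ord -[leLHS]mulr_natl.
  have m0 : 0 < m.+1%:R :> R by rewrite ltr0n.
  have := lexx (8 * K ^+ 2); move: bq b2 b0 q0 m0; move: (m.+1%:R) => s.
  have := sqr_ge0 K; move: (K ^+ 2) => k k0 bq b2 b0 q0 s0 _.
  clearbody b q.
  have h1 : (s * (b * q)) ^+ 2 <= (8 * k) ^+ 2.
    by rewrite ler_sqr ?nnegrE ?mulr_ge0 ?(ltW s0).
  rewrite -(ler_pM2l s0).
  have h2 : s ^+ 2 * q ^+ 2 <= (b ^+ 2 * (8 * s)) * (s ^+ 2 * q ^+ 2).
    by rewrite ler_peMl // mulr_ge0 ?sqr_ge0.
  have h3 := ler_wpM2l (ltW s0) h1.
  by lra.
apply/rnorm_eq0/eqP; rewrite -sqrf_eq0 -/q -sqrf_eq0.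
apply/eqP/le_anti; rewrite sqr_ge0 andbT leNgt; apply/negP => qq.
have := archi_boundP (divr_ge0 (mulr_ge0 (ler0n _ 512) (sqr_ge0 (K ^+ 2))) (ltW qq)).
set N := Num.bound _; rewrite ltr_pdivrMr // => h.
have := main N; rewrite leNgt => /negP; apply.
by apply: lt_le_trans h _; rewrite ler_wpM2r ?(ltW qq) ?ler_nat.
Qed.

End Bimodule.

(** * Weak* limits against products and the involution *)

Section WeakStarAlgebra.
Variables (R : realType) (A : cstarAlgType R) (D : predual A) (U : set_system nat).
Hypotheses (U_ultra : UltraFilter U).
Implicit Types (x y : nat -> A) (a b g w : A).
Notation wcvg := (wcvg D U).

Definition rbounded x := exists K : R, forall n, rnorm (x n) <= K.

Lemma rboundedD x y : rbounded x -> rbounded y -> rbounded (fun n => x n + y n).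
Proof.
move=> [K xK] [L yL]; exists (K + L) => n.
by rewrite (le_trans (rnormD _ _)) // lerD.
Qed.

Lemma rboundedZ (c : R[i]) x : rbounded x -> rbounded (fun n => c *: x n).
Proof.
move=> [K xK]; exists (complex.Re `|c| * K) => n; rewrite rnormZ ler_wpM2l //.
by rewrite normc_def /= sqrtr_ge0.
Qed.

Lemma rboundedM b x : rbounded x -> rbounded (fun n => b * x n).
Proof.
move=> [K xK]; exists (rnorm b * K) => n.
by rewrite (le_trans (rnormM _ _)) // ler_wpM2l ?rnorm_ge0.
Qed.

Lemma rbounded_star x : rbounded x -> rbounded (fun n => star (x n)).
Proof. by move=> [K xK]; exists K => n; rewrite rnorm_star. Qed.

Lemma rbounded_ex x : rbounded x -> exists a, wcvg x a.
Proof. by move=> [K xK]; exact: wcvg_ex xK. Qed.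

Lemma wcvgB x y a b : wcvg x a -> wcvg y b -> wcvg (fun n => x n - y n) (a - b).
Proof.
move=> xa yb; have := wcvgD U_ultra xa (wcvgZ U_ultra (c := -1) yb); rewrite scaleN1r.
by under eq_fun do rewrite scaleN1r.
Qed.

(** Take y_n = w (x_n - a): then star w y_n = x_n - a tends to 0, and w y_n tends to c - w w a,
    where c is the limit of w w x_n. This is why the square of [w] appears. *)
Lemma wcvg_mull_unitary2 w x a : star w * w = 1 -> w * star w = 1 ->
  rbounded x -> wcvg x a -> wcvg (fun n => w * w * x n) (w * w * a).
Proof.
move=> ww ww' xK xa; have [c xc] := rbounded_ex (rboundedM (w * w) xK).
have [L yL] : rbounded (fun n => w * (x n - a)).
  apply/rboundedM/rboundedD => //; exists (rnorm (- a)) => n //.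
suff -> : w * w * a = c by [].
apply/esym/subr0_eq; apply: (wcvg_unitary0 U_ultra ww ww' yL).
  under eq_fun do rewrite mulrA ww mul1r.
  have h := wcvgB xa (wcvg_cst U_ultra (a := a)); rewrite subrr in h.
  exact: h.
under eq_fun do rewrite mulrA mulrBr.
have h := wcvgB xc (wcvg_cst U_ultra (a := w * w * a)).
exact: h.
Qed.

Definition mull_wcvg b := forall x a,
  rbounded x -> wcvg x a -> wcvg (fun n => b * x n) (b * a).

Lemma mull_wcvgD b c : mull_wcvg b -> mull_wcvg c -> mull_wcvg (b + c).
Proof.
move=> hb hc x a xK xa; rewrite mulrDl; under eq_fun do rewrite mulrDl.
by apply: wcvgD; [exact: hb | exact: hc].
Qed.

Lemma mull_wcvgZ (k : R[i]) b : mull_wcvg b -> mull_wcvg (k *: b).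
Proof.
move=> hb x a xK xa; rewrite scaleAl; under eq_fun do rewrite scaleAl.
exact: (wcvgZ U_ultra (hb _ _ xK xa)).
Qed.

(** With h the root of 1 - g^2, the element w = h + i g is unitary, and w^2 + (star w)^2 = 2 (h^2 -
    g^2) = 2 - 4 g^2 expresses g^2 through squares of unitaries. *)
Lemma mull_wcvg_sqr g : selfadj g -> rnorm g <= 1 -> mull_wcvg (g * g).
Proof.
move=> sg g1; have N2 : rnorm (g * g) <= 1 by rewrite rnorm_sqr // expr_le1 ?rnorm_ge0.
have := psq_subr (selfadjM sg sg erefl) N2; rewrite scale1r.
move=> /psq_bicomm_root[h [/psq_selfadj sh ch hE]].
have gh : g * h = h * g by apply: ch; rewrite mulrBr mulrBl mulr1 mul1r mulrA.
pose w := h + 'i *: g.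
have sw : star w = h - 'i *: g.
  rewrite /w starD starZc sh sg -scaleNr; congr (_ + _ *: _); apply/eqP.
  by rewrite eq_complex /= oppr0 !eqxx.
have i2 : 'i * 'i = -1 :> R[i] by rewrite -expr2 sqr_i.
have ww : star w * w = 1.
  rewrite sw /w.
  have -> : (h - 'i *: g) * (h + 'i *: g) =
    h * h - ('i * 'i) *: (g * g) + 'i *: (h * g - g * h) by ncring.
  by rewrite gh subrr scaler0 addr0 i2 scaleN1r opprK -hE subrK.
have ww' : w * star w = 1.
  rewrite sw /w.
  have -> : (h + 'i *: g) * (h - 'i *: g) =
    h * h - ('i * 'i) *: (g * g) + 'i *: (g * h - h * g) by ncring.
  by rewrite gh subrr scaler0 addr0 i2 scaleN1r opprK -hE subrK.
have -> : g * g = 4^-1%:C *: (2%:C *: (1 : A) + (-1) *: (w * w + star w * star w)).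
  have -> : w * w + star w * star w = 2%:C *: (h * h + ('i * 'i) *: (g * g)).
    by rewrite sw /w; ncring.
  by rewrite -hE i2; ncring.
apply: mull_wcvgZ; apply: mull_wcvgD.
  apply: mull_wcvgZ => x a _ xa; rewrite mul1r.
  by under eq_fun do rewrite mul1r.
apply: mull_wcvgZ; apply: mull_wcvgD => x a xK xa.
  exact: wcvg_mull_unitary2.
by apply: wcvg_mull_unitary2 => //; rewrite starK.
Qed.

(** Polarization 4 b = (b + 1)^2 - (b - 1)^2; division by s = |b| + 1 makes both bases
    contractions. *)
Lemma mull_wcvg_selfadj b : selfadj b -> mull_wcvg b.
Proof.
move=> sb; pose s : R := rnorm b + 1; have s0 : 0 < s by rewrite ltr_wpDl ?rnorm_ge0.
have hN (e : A) : selfadj e -> rnorm e <= 1 ->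
    mull_wcvg ((s^-1%:C *: (b + e)) * (s^-1%:C *: (b + e))).
  move=> se e1; apply: mull_wcvg_sqr; first exact/selfadjZ/selfadjD.
  rewrite rnormZR ger0_norm ?invr_ge0 ?(ltW s0) // ler_pdivrMl // mulr1.
  by rewrite (le_trans (rnormD _ _)) // lerD2l.
have -> : b = (s ^+ 2 / 4)%:C *:
    ((s^-1%:C *: (b + 1)) * (s^-1%:C *: (b + 1)) +
     (-1) *: ((s^-1%:C *: (b + (-1))) * (s^-1%:C *: (b + (-1))))).
  have E : (s ^+ 2 / 4)%:C * (s^-1%:C * s^-1%:C) = 4^-1%:C.
    by rewrite -!rmorphM /=; congr (_%:C); field; rewrite gt_eqF.
  move: (s^-1%:C) ((s ^+ 2 / 4)%:C) E => k l E.
  rewrite [RHS](_ : _ =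
    (l * (k * k)) *: ((b + 1) * (b + 1) - (b - 1) * (b - 1))); last by ncring.
  by rewrite E; ncring.
apply: mull_wcvgZ; apply: mull_wcvgD.
  by apply: hN; [exact: selfadj1 | exact: rnorm1_le].
apply/mull_wcvgZ/hN; first exact/selfadjN/selfadj1.
by rewrite rnormN rnorm1_le.
Qed.

Lemma cartesian b : exists h k, [/\ selfadj h, selfadj k & b = h + 'i *: k].
Proof.
exists (2^-1%:C *: (b + star b)), ((2^-1%:C * 'i) *: (star b - b)); split.
- by rewrite /selfadj starZR starD starK addrC.
- rewrite /selfadj starZc starB starK -opprB scalerN -scaleNr; congr (_ *: _).
  by apply/eqP; rewrite eq_complex /=; apply/andP; split; apply/eqP; ring.
have i2 : 'i * 'i = -1 :> R[i] by rewrite -expr2 sqr_i.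
by rewrite scalerA mulrCA i2; ncring.
Qed.

Lemma wcvg_mull b x a : rbounded x -> wcvg x a -> wcvg (fun n => b * x n) (b * a).
Proof.
have [h [k [sh sk ->]]] := cartesian b.
by apply: mull_wcvgD; [|apply: mull_wcvgZ]; exact: mull_wcvg_selfadj.
Qed.

(** For selfadjoint x_n, |1 + i s x_n| <= sqrt (1 + s^2 K^2), which has no term linear in s, and
    this survives in the limit. Taking real parts gives |1 + s b| <= 1 + s^2 K^2 / 2, where [b] is
    up to sign the imaginary part of [a]; for small s of either sign this forces [b] and [- b] to be
    positive. *)
Lemma wcvg_selfadj x a :
  (forall n, selfadj (x n)) -> rbounded x -> wcvg x a -> selfadj a.
Proof.
move=> sx [K xK] xa.
have i2 : 'i * 'i = -1 :> R[i] by rewrite -expr2 sqr_i.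
have kJ (s : R) : conjc (s%:C * 'i) = - (s%:C * 'i).
  by apply/eqP; rewrite eq_complex /=; apply/andP; split; apply/eqP; ring.
have x_bound (s : R) n : rnorm (1 + (s%:C * 'i) *: x n) <= Num.sqrt (1 + (s * K) ^+ 2).
  rewrite -[leLHS]ger0_norm ?rnorm_ge0 // -sqrtr_sqr ler_wsqrtr // -rnorm_starM.
  have -> : star (1 + (s%:C * 'i) *: x n) * (1 + (s%:C * 'i) *: x n) =
      1 + (s%:C *: x n) * (s%:C *: x n).
    rewrite starD star1 starZc sx kJ.
    have -> : (1 + (- (s%:C * 'i)) *: x n) * (1 + (s%:C * 'i) *: x n) =
      1 - (s%:C * s%:C * ('i * 'i)) *: (x n * x n) by ncring.
    by rewrite i2 mulrN1 scaleNr opprK scaleAl scaleAr scalerA.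
  rewrite (le_trans (rnormD _ _)) // lerD ?rnorm1_le // rnorm_sqr; last exact: selfadjZ.
  rewrite rnormZR -[leRHS]real_normK ?num_real // normrM ler_sqr ?nnegrE ?mulr_ge0 ?rnorm_ge0 //.
  by rewrite ler_wpM2l // (le_trans (xK n)) // ler_norm.
have a_bound s : rnorm (1 + (s%:C * 'i) *: a) <= Num.sqrt (1 + (s * K) ^+ 2).
  apply: (wcvg_le U_ultra _ (x_bound s)); apply: wcvgD; first exact: wcvg_cst.
  exact: wcvgZ.
pose b : A := (2^-1%:C * 'i) *: (a - star a).
have sb : selfadj b.
  rewrite /selfadj starZc starB starK -opprB scalerN -scaleNr; congr (_ *: _).
  by apply/eqP; rewrite eq_complex /=; apply/andP; split; apply/eqP; ring.
have b_bound s : rnorm (1 + s%:C *: b) <= 1 + (s * K) ^+ 2 / 2.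
  have -> : 1 + s%:C *: b = 2^-1%:C *:
      ((1 + (s%:C * 'i) *: a) + star (1 + (s%:C * 'i) *: a)).
    rewrite starD star1 starZc kJ /b.
    by ncring.
  rewrite rnormZR ger0_norm ?invr_ge0 //.
  have h1 := rnormD (1 + (s%:C * 'i) *: a) (star (1 + (s%:C * 'i) *: a)).
  rewrite rnorm_star in h1.
  have h2 : Num.sqrt (1 + (s * K) ^+ 2) <= 1 + (s * K) ^+ 2 / 2.
    have p := sqr_ge0 (s * K); set q := (s * K) ^+ 2 in p *.
    have q1 : 0 <= 1 + q / 2 by lra.
    have q2 : 0 <= 1 + q by lra.
    rewrite -ler_sqr ?nnegrE ?sqrtr_ge0 // sqr_sqrtr //.
    by have := sqr_ge0 q; lra.
  have := a_bound s; lra.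
have sgn (s e : R) : s ^+ 2 = 1 -> 0 < e -> psq (s%:C *: b + e%:C *: (1 : A)).
  (* [r] is small enough for r K^2 / 2 <= e, the error left after division by [r]; the summand 1
     keeps the denominator positive when K = 0. *)
  move=> s2 e0; pose r : R := 2 * e / (K ^+ 2 + 1).
  have K1 : 0 < K ^+ 2 + 1 by rewrite ltr_wpDl ?sqr_ge0.
  have r0 : 0 < r by rewrite divr_gt0 // mulr_gt0.
  have re : 0 <= e - r * K ^+ 2 / 2.
    have -> : e = r * (K ^+ 2 + 1) / 2 by rewrite /r divfK ?gt_eqF //; lra.
    by have := ltW r0; lra.
  clearbody r.
  have h : rnorm (1 + (- (s * r))%:C *: b) <= 1 + r ^+ 2 * K ^+ 2 / 2.
    apply: le_trans (b_bound _) _.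
    have -> : (- (s * r) * K) ^+ 2 = s ^+ 2 * (r ^+ 2 * K ^+ 2) by ring.
    by rewrite s2 mul1r.
  have s1 : selfadj (1 + (- (s * r))%:C *: b).
    by apply: selfadjD; [exact: selfadj1 | exact: selfadjZ].
  have : psq ((r ^+ 2 * K ^+ 2 / 2)%:C *: (1 : A) + (s * r)%:C *: b).
    by have := psq_subr s1 h; congr psq; ncring.
  have ri : 0 <= r^-1 by rewrite invr_ge0 ltW.
  move=> /(psqZ ri); rewrite scalerDr !scalerA -!rmorphM /= [s * r]mulrC mulKf ?gt_eqF //.
  have -> : r^-1 * (r ^+ 2 * K ^+ 2 / 2) = r * K ^+ 2 / 2.
    by field; rewrite gt_eqF.
  move=> /psqD/(_ (psqZ re (psq1 A))); rewrite addrAC -scalerDl -rmorphD /= subrKC.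
  by rewrite addrC.
have /psq_closed pb : forall e, 0 < e -> psq (b + e%:C *: (1 : A)).
  by move=> e /(@sgn 1); rewrite scale1r; apply; rewrite expr1n.
have /psq_closed nb : forall e, 0 < e -> psq (- b + e%:C *: (1 : A)).
  move=> e /(@sgn (-1)); rewrite rmorphN /= scaleNr scale1r; apply.
  by rewrite sqrrN expr1n.
have b0 := psq_antisym pb nb.
have : a - star a = (2%:C * - 'i) *: b.
  have -> : (2%:C * - 'i) *: b = (- ('i * 'i)) *: (a - star a) by rewrite /b; ncring.
  by rewrite i2 opprK scale1r.
by rewrite b0 scaler0 => /subr0_eq.
Qed.

(** Turns [star a = b] into two selfadjointness conditions linear in a and b, the form in which
    weak* limits and polarization deliver it. *)
Lemma star_eqP a b : selfadj (a + b) -> selfadj ('i *: (a - b)) -> star a = b.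
Proof.
move=> h1; have i0 : 'i != 0 :> R[i] by rewrite eq_complex /= oner_eq0 andbF.
have iJ : conjc 'i = - 'i :> R[i] by apply/eqP; rewrite eq_complex /= oppr0 !eqxx.
rewrite /selfadj starZc iJ scaleNr -scalerN => /(scalerI i0); rewrite starB => h2.
have {}h2 : star a - star b = - (a - b) by rewrite -h2 opprK.
have -> : star a = 2^-1%:C *: ((star a + star b) + (star a - star b)) by ncring.
by rewrite -starD h1 h2; ncring.
Qed.

Lemma wcvg_star x a : rbounded x -> wcvg x a -> wcvg (fun n => star (x n)) (star a).
Proof.
move=> xK xa; have sK := rbounded_star xK; have [b xb] := rbounded_ex sK.
suff -> : star a = b by [].
apply: star_eqP.
  apply: (@wcvg_selfadj (fun n => x n + star (x n))); last exact: wcvgD.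
    by move=> n; rewrite /selfadj starD starK addrC.
  exact: rboundedD.
apply: (@wcvg_selfadj (fun n => 'i *: (x n - star (x n)))).
- have iJ : conjc 'i = - 'i :> R[i] by apply/eqP; rewrite eq_complex /= oppr0 !eqxx.
  move=> n; rewrite /selfadj starZc iJ starB starK.
  by rewrite -opprB scalerN scaleNr opprK.
- apply: rboundedZ; apply: rboundedD => //.
  by have [K h] := sK; exists K => n; rewrite rnormN.
- by apply: wcvgZ; exact: wcvgB.
Qed.

Lemma wcvg_mulr b x a : rbounded x -> wcvg x a -> wcvg (fun n => x n * b) (a * b).
Proof.
move=> xK xa; rewrite -[a * b]starK starMr.
under eq_fun do rewrite -[_ * b]starK starMr.
apply: wcvg_star; first exact/rboundedM/rbounded_star.
by apply: wcvg_mull; [exact: rbounded_star | exact: wcvg_star].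
Qed.

(** The criterion |K - x_n| <= K is a norm bound, hence is inherited by the limit. *)
Lemma wcvg_psq x a : (forall n, psq (x n)) -> rbounded x -> wcvg x a -> psq a.
Proof.
move=> px xK xa; have sa : selfadj a.
  by apply: wcvg_selfadj xK xa => n; exact: psq_selfadj.
have [K {}xK] := xK; apply: (@psqP _ _ _ K) => //.
apply: (wcvg_le U_ultra (x := fun n => K%:C *: (1 : A) - x n)).
  have h := wcvgB (wcvg_cst U_ultra (a := K%:C *: (1 : A))) xa.
  exact: h.
by move=> n; exact: psq_rnorm.
Qed.

End WeakStarAlgebra.

(** * Schur complements with an approximate inverse *)

Section Cholesky.
Variables (R : realType) (A : cstarAlgType R) (D : predual A) (U : set_system nat).
Hypotheses (U_ultra : UltraFilter U) (U_free : \oo `<=` U).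
Notation wcvg := (wcvg D U).

Definition psd n (X : 'M[A]_n) := forall v : 'cV[A]_n, psq (dot v (X *m v)).

(** Polarization: positivity at v + w and at v + w i gives the two conditions of [star_eqP]. *)
Lemma psd_hermitian n (X : 'M[A]_n) (v w : 'cV[A]_n) :
  psd X -> star (dot v (X *m w)) = dot w (X *m v).
Proof.
move=> pX; have qD u u' : selfadj (dot u (X *m u') + dot u' (X *m u)).
  have := psq_selfadj (pX (u + u')); rewrite mulmxDr dotDl !dotDr => h.
  have hu := psq_selfadj (pX u); have hu' := psq_selfadj (pX u').
  have -> : dot u (X *m u') + dot u' (X *m u) =
    dot u (X *m u) + dot u (X *m u') + (dot u' (X *m u) + dot u' (X *m u')) -
    dot u (X *m u) - dot u' (X *m u') by ncring.
  by apply/selfadjB => //; exact/selfadjB.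
apply: star_eqP; first exact: qD.
have := qD v (vscale w ('i *: (1 : A))).
have iJ : conjc 'i = - 'i :> R[i] by apply/eqP; rewrite eq_complex /= oppr0 !eqxx.
rewrite mulmx_vscale dot_vscaler dot_vscalel starZc star1 iJ.
by rewrite scaleAl scaleAr mul1r mulr1 scaleNr -scalerBr.
Qed.

Lemma psd_star n (X : 'M[A]_n) i j : psd X -> star (X i j) = X j i.
Proof.
have E (Y : 'M[A]_n) k l : dot (delta_mx k 0) (Y *m delta_mx l 0) = Y k l.
  rewrite /dot (bigD1 k) //= big1 ?addr0 => [|k' /negbTE k'k]; last first.
    by rewrite mxE k'k star0 mul0r.
  rewrite !mxE !eqxx star1 mul1r (bigD1 l) //= big1 ?addr0 => [|l' /negbTE l'l]; last first.
    by rewrite mxE l'l mulr0.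
  by rewrite mxE !eqxx mulr1.
by move=> pX; rewrite -{1}(E X i j) psd_hermitian // E.
Qed.

Lemma dot_col_mx m n (u u' : 'cV[A]_m) (v v' : 'cV[A]_n) :
  dot (col_mx u v) (col_mx u' v') = dot u u' + dot v v'.
Proof.
by rewrite /dot big_split_ord /=; congr (_ + _); apply: eq_bigr => i _;
  rewrite ?col_mxEu ?col_mxEd.
Qed.

(* The partial sums i_n of the Neumann series of a^-1, so that
   a i_n = 1 - z^n with z = 1 - a/T. *)
Definition neumann (a : A) (T : R) n : A :=
  T^-1%:C *: \sum_(k < n) (1 - T^-1%:C *: a) ^+ k.

Section Neumann.
Variables (a : A) (T : R).
Hypotheses (T0 : 0 < T) (pa : psq a) (aT : rnorm a <= T).
Let z := 1 - T^-1%:C *: a.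
Let i_ n := neumann a T n.

Lemma psq_neumann_z : psq z.
Proof.
have Ti : 0 <= T^-1 by rewrite invr_ge0 ltW.
have := psqZ Ti (psq_subr (psq_selfadj pa) aT).
by rewrite scalerBr scalerA -rmorphM /= mulVf ?gt_eqF // scale1r.
Qed.

Lemma psq_1B_neumann_z : psq (1 - z).
Proof. by rewrite subKr; apply: psqZ => //; rewrite invr_ge0 ltW. Qed.

Lemma psq_neumann n : psq (i_ n).
Proof.
apply: psqZ; first by rewrite invr_ge0 ltW.
by apply: psq_sum => k _; apply: psqX; exact: psq_neumann_z.
Qed.

Lemma neumann_bicomm n : bicomm a (i_ n).
Proof.
move=> x xa; rewrite scaleAr scaleAl; congr (_ *: _).
rewrite mulr_sumr mulr_suml; apply: eq_bigr => k _.
elim: (nat_of_ord k) => [|j IH]; first by rewrite mulr1 mul1r.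
rewrite exprS mulrA -[RHS]mulrA -IH !mulrA; congr (_ * _).
by rewrite mulrBr mulrBl mulr1 mul1r scaleAr scaleAl xa.
Qed.

Lemma neumannM n : a * i_ n = 1 - z ^+ n.
Proof.
have -> : a * i_ n = (1 - z) * \sum_(k < n) z ^+ k.
  by rewrite subKr scaleAl scaleAr.
rewrite mulr_sumr; elim: n => [|n IH]; first by rewrite big_ord0 subrr.
by rewrite big_ord_recr /= IH exprS mulrBl mul1r addrA subrK.
Qed.

(** As 0 <= z <= 1, each of the n powers z^k with k < n dominates z^(2n). *)
Lemma psq_neumannB n : psq (i_ n - (n%:R / T)%:C *: z ^+ (2 * n)).
Proof.
have -> : i_ n - (n%:R / T)%:C *: z ^+ (2 * n) =
    T^-1%:C *: \sum_(k < n) (z ^+ k - z ^+ (2 * n)).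
  rewrite sumrB sumr_const card_ord scalerBr mulrC rmorphM /= rmorph_nat.
  by rewrite -scalerA scaler_nat.
apply: psqZ; first by rewrite invr_ge0 ltW.
apply: psq_sum => k _; have pz := psq_neumann_z.
have -> : z ^+ k - z ^+ (2 * n) = z ^+ k * (1 - z ^+ (2 * n - k)).
  rewrite mulrBr mulr1 -exprD subnKC //.
  by apply: leq_trans (ltnW (ltn_ord k)) _; lia.
apply: psq_comm_mul; [exact: psqX | |].
  by apply: psq_1BX => //; exact: psq_1B_neumann_z.
by rewrite mulrBl mulrBr mul1r mulr1 commrXX.
Qed.

(* In what follows d and B stand for the values at a vector u of the corner
   form and of the off-diagonal row of a positive block matrix. *)
Variables (B d : A).
Hypothesis block_psq : forall p,
  psq (star p * a * p + star p * B + star B * p + d).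

(** The block form would be least at p = - a^-1 B; [i_ n] replaces the inverse, and i_n a i_n = i_n
    (1 - z^n) accounts for the extra summand. *)
Lemma psq_schur n : psq (d - star B * (i_ n + i_ n * z ^+ n) * B).
Proof.
have ai := neumannM n; have ia : i_ n * a = 1 - z ^+ n.
  by rewrite -ai; symmetry; apply: neumann_bicomm.
have := block_psq (- (i_ n * B)).
rewrite starN starMr (psq_selfadj (psq_neumann n)); congr psq.
have -> : - (star B * i_ n) * a * - (i_ n * B) = star B * (i_ n * (a * i_ n)) * B.
  by rewrite mulrN !mulNr opprK !mulrA.
by rewrite ai; ncring.
Qed.

Lemma psq_neumann_zX n : psq (star B * (i_ n * z ^+ n) * B).
Proof.
apply/psq_conj/psq_comm_mul; [exact: psq_neumann | exact/psqX/psq_neumann_z |].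
have zi : z * i_ n = i_ n * z.
  by apply: neumann_bicomm; rewrite mulrBl mulrBr mul1r mulr1 scaleAl scaleAr.
elim: (n in z ^+ n) => [|m IH]; first by rewrite mulr1 mul1r.
by rewrite exprS -mulrA -IH !mulrA zi.
Qed.

(** [r * i_ n] plays the role of the inverse of [r], so [r * i_ n * B] approximates the off-diagonal
    Cholesky entry. Its square is star B i_n (1 - z^n) B, smaller than what [psq_schur]
    subtracts. *)
Lemma psq_approx r n : selfadj r -> a = r * r ->
  psq (d - star (r * i_ n * B) * (r * i_ n * B)).
Proof.
move=> sr rE; rewrite !starMr sr (psq_selfadj (psq_neumann n)).
have -> : star B * (i_ n * r) * (r * i_ n * B) = star B * (i_ n * (a * i_ n)) * B.
  by rewrite rE !mulrA.
rewrite neumannM.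
have -> : d - star B * (i_ n * (1 - z ^+ n)) * B =
   (d - star B * (i_ n + i_ n * z ^+ n) * B) + 2%:C *: (star B * (i_ n * z ^+ n) * B).
  by ncring.
apply: psqD; first exact: psq_schur.
by apply: psqZ; [exact: ler0n | exact: psq_neumann_zX].
Qed.

(** The chain (n / T) star B z^(2n) B <= star B i_n B <= d. It makes z^n B tend to 0 in norm
    although [a] need not be invertible: positivity of the block controls [B] where [a] is small. *)
Lemma rnorm_zX_le n : n%:R * rnorm (z ^+ n * B) ^+ 2 <= T * rnorm d.
Proof.
rewrite -rnorm_starM starMr starX (psq_selfadj psq_neumann_z) mulrA.
rewrite -(mulrA (star B)) -exprD addnn -mul2n.
set y := star B * z ^+ (2 * n) * B; have nT : 0 <= n%:R / T by rewrite divr_ge0 // ltW.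
suff : rnorm ((n%:R / T)%:C *: y) <= rnorm d.
  by rewrite rnormZR ger0_norm // mulrAC ler_pdivrMr // mulrC [T * _]mulrC.
apply: psq_rnorm_le.
  by apply/psqZ => //; apply/psq_conj/psqX/psq_neumann_z.
have -> : d - (n%:R / T)%:C *: y =
    (d - star B * (i_ n + i_ n * z ^+ n) * B) + star B * (i_ n * z ^+ n) * B +
    star B * (i_ n - (n%:R / T)%:C *: z ^+ (2 * n)) * B by rewrite /y; ncring.
apply: psqD; last exact/psq_conj/psq_neumannB.
by apply: psqD; [exact: psq_schur | exact: psq_neumann_zX].
Qed.

End Neumann.

Lemma wcvg_sum n (x : 'I_n -> nat -> A) (a : 'I_n -> A) :
  (forall i, wcvg (x i) (a i)) ->
  wcvg (fun k => \sum_i x i k) (\sum_i a i).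
Proof.
elim: n x a => [|n IH] x a xa.
  rewrite big_ord0; under eq_fun do rewrite big_ord0.
  exact: wcvg_cst.
rewrite big_ord_recl; under eq_fun do rewrite big_ord_recl.
by apply: wcvgD => //; apply: IH.
Qed.

Lemma rbounded_sum n (x : 'I_n -> nat -> A) :
  (forall i, rbounded (x i)) -> rbounded (fun k => \sum_i x i k).
Proof.
elim: n x => [|n IH] x xK.
  by exists 0 => k; rewrite big_ord0 rnorm0.
under eq_fun do rewrite big_ord_recl.
by apply: rboundedD => //; apply: IH.
Qed.

(** [star x * x] is not weak*-continuous. Adding the square of x_n - y cancels the quadratic term
    and leaves an expression real-affine in x_n, whose limit is known. *)
Lemma wcvg_psq_le (x : nat -> A) y d :
  (forall n, psq (d - star (x n) * x n)) -> rbounded x -> wcvg x y ->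
  psq (d - star y * y).
Proof.
move=> px xK xy.
have xsK := rbounded_star xK; have xsy := wcvg_star U_ultra xK xy.
have cK a : rbounded (fun _ : nat => a) by exists (rnorm a).
apply: (@wcvg_psq _ _ D U U_ultra
    (fun n => (d + star y * y) + (-1) *: (star y * x n + star (x n) * y))).
- move=> n; have -> : (d + star y * y) + (-1) *: (star y * x n + star (x n) * y) =
      (d - star (x n) * x n) + star (x n - y) * (x n - y).
    by rewrite starB; ncring.
  by apply: psqD => //; exact: psq_starM.
- apply: rboundedD => //; apply: rboundedZ; apply: rboundedD; first exact: rboundedM.
  have [K h] := xsK; exists (K * rnorm y) => n.
  by rewrite (le_trans (rnormM _ _)) // ler_wpM2r ?rnorm_ge0.
have -> : d - star y * y = (d + star y * y) + (-1) *: (star y * y + star y * y).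
  by ncring.
apply: wcvgD; first exact: wcvg_cst.
apply: wcvgZ; apply: wcvgD; first exact: wcvg_mull.
exact: wcvg_mulr.
Qed.

End Cholesky.

(** * Factorization of positive matrices *)

Section Factorization.
Variables (R : realType) (A : cstarAlgType R) (D : predual A) (U : set_system nat).
Hypotheses (U_ultra : UltraFilter U) (U_free : \oo `<=` U).
Notation wcvg := (wcvg D U).

Lemma rcvg_sqrt (x : nat -> A) (c : R) :
  (forall n, n%:R * rnorm (x n) ^+ 2 <= c) -> rcvg x 0.
Proof.
move=> xc e e0; have e2 : 0 < e ^+ 2 by rewrite exprn_gt0.
have c0 : 0 <= c by have := xc 0; rewrite mul0r.
exists (Num.bound (c / e ^+ 2)) => n n0; rewrite subr0 -ler_sqr ?nnegrE ?rnorm_ge0 ?(ltW e0) //.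
have := archi_boundP (divr_ge0 c0 (ltW e2)); rewrite ltr_pdivrMr // => h.
rewrite leNgt; apply/negP => xe.
have : c < n%:R * rnorm (x n) ^+ 2.
  apply: lt_le_trans h _; apply: ler_pM; rewrite ?ler0n ?ler_nat ?(ltW e2) //.
  exact: ltW.
by rewrite ltNge xc.
Qed.

Lemma psd_mx_ge0 n (X : 'M[A]_n) : psd X -> mx_ge0 X.
Proof.
elim: n X => [|n IH] X pX; first by exists 0; apply/matrixP => -[].
move: X pX; rewrite -[n.+1]/(1 + n)%N => X pX.
pose a := X 0 0; pose b := ursubmx X; pose d := drsubmx X.
have XE : X = block_mx (const_mx a) b (adjmx b) d.
  rewrite -[LHS]submxK; congr block_mx.
    by apply/matrixP => i j; rewrite !ord1 !mxE; congr (X _ _); apply/val_inj.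
  by apply/matrixP => i j; rewrite !mxE psd_star.
clearbody a b d.
have block p (u : 'cV[A]_n) : psq (star p * a * p + star p * (b *m u) 0 0 +
    star ((b *m u) 0 0) * p + dot u (d *m u)).
  have := pX (col_mx (const_mx p) u); rewrite {1}XE mul_block_col dot_col_mx; congr psq.
  rewrite dotDr {1 2}/dot !big_ord1 !mxE big_ord1 !mxE dotDr !mulrA !addrA; congr (_ + _ + _).
  rewrite star_sum mulr_suml; apply: eq_bigr => i _.
  by rewrite !mxE big_ord1 !mxE starMr mulrA.
have pa : psq a.
  have := block 1 0; rewrite mulmx0 mxE star0 mul0r mulr0 !addr0 star1 mul1r mulr1.
  by rewrite mulmx0 /dot big1 ?addr0 // => i _; rewrite [(0 : 'cV_n) i 0]mxE star0 mul0r.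
pose T := rnorm a + 1; have T0 : 0 < T by rewrite ltr_wpDl ?rnorm_ge0.
have aT : rnorm a <= T by rewrite lerDl.
have [r [/psq_selfadj sr rbi rE]] := psq_bicomm_root pa.
pose c (u : 'cV[A]_n) k := r * neumann a T k * (b *m u) 0 0.
have c_le u k : psq (dot u (d *m u) - star (c u k) * c u k).
  exact: (psq_approx T0 pa aT (block ^~ u)).
have c_bd u : rbounded (c u).
  exists (Num.sqrt (rnorm (dot u (d *m u)))) => k.
  rewrite -[leLHS]ger0_norm ?rnorm_ge0 // -sqrtr_sqr ler_wsqrtr // -rnorm_starM.
  exact: psq_rnorm_le (psq_starM _) (c_le u k).
(* [r * c u k] equals (1 - z^k) applied to the value of [b] at [u], and the part with z^k tends to 0
   by [rnorm_zX_le]. *)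
have rc u : wcvg (fun k => r * c u k) ((b *m u) 0 0).
  have h : rcvg (fun k => (-1) *: ((1 - T^-1%:C *: a) ^+ k * (b *m u) 0 0)) 0.
    apply: (@rcvg_sqrt _ (T * rnorm (dot u (d *m u)))) => k.
    by rewrite scaleN1r rnormN; exact: (rnorm_zX_le T0 pa aT (block ^~ u)).
  have := wcvgD U_ultra (wcvg_null U_ultra U_free h) (wcvg_cst U_ultra (a := (b *m u) 0 0)).
  rewrite add0r (_ : (fun k => _) = fun k => r * c u k) //; apply/funext => k.
  rewrite /c !mulrA -rE neumannM.
  by move: (_ ^+ k) => z; ncring.
have [gam gamP] : exists gam : 'rV[A]_n,
    forall j, wcvg (c (delta_mx j 0)) (gam 0 j).
  have h j := rbounded_ex D U_ultra (c_bd (delta_mx j 0)).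
  exists (\row_j projT1 (cid (h j))) => j; rewrite mxE; exact: projT2 (cid (h j)).
have rgam j : r * gam 0 j = b 0 j.
  have := wcvg_unique U_ultra (wcvg_mull U_ultra (b := r) (c_bd _) (gamP j)) (rc _).
  by move=> ->; rewrite -colE [col j b 0 0]mxE.
(* The limits [gam] were chosen at basis vectors only; continuity of right multiplication extends
   them to every [u]. This makes the Schur complement [d - adjmx gam *m gam] positive at every
   vector, as the induction requires. *)
have c_cvg u : wcvg (c u) ((gam *m u) 0 0).
  have -> : c u = fun k => \sum_j c (delta_mx j 0) k * u j 0.
    apply/funext => k; rewrite /c mxE mulr_sumr; apply: eq_bigr => j _.
    by rewrite -colE [col j b 0 0]mxE mulrA.
  rewrite mxE; apply: (wcvg_sum U_ultra) => j.
  exact: (wcvg_mulr U_ultra (b := u j 0) (c_bd _) (gamP j)).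
have pd' : psd (d - adjmx gam *m gam).
  move=> u; have := wcvg_psq_le U_ultra (c_le u) (c_bd u) (c_cvg u); congr psq.
  rewrite -!dotE mulmxBl mulmxBr [in RHS]mxE; congr (_ + _).
  rewrite [in RHS]mxE; congr (- _).
  by rewrite -mulmxA mulmxA -adjmxM [in RHS]mxE big_ord1 !mxE.
have [Z ZE] := IH _ pd'.
exists (block_mx (const_mx r) gam 0 Z); rewrite XE.
have -> : adjmx (block_mx (const_mx r) gam 0 Z) =
    block_mx (const_mx r : 'M[A]_1) 0 (adjmx gam) (adjmx Z).
  rewrite /adjmx tr_block_mx map_block_mx; congr block_mx.
    by apply/matrixP => i j; rewrite !mxE.
  by apply/matrixP => i j; rewrite !mxE star0.
rewrite mulmx_block !mul0mx !mulmx0 !addr0 -ZE subrKC; congr block_mx.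
- by apply/matrixP => i j; rewrite !mxE big_ord1 !mxE.
- by apply/matrixP => i j; rewrite !mxE big_ord1 !mxE !ord1 rgam.
- apply/matrixP => i j; rewrite !mxE big_ord1 !mxE !ord1 -rgam starMr sr.
  by [].
Qed.

End Factorization.

(** * Cesaro means and their limit *)

Section CesaroMeans.
Variables (R : realType) (A : cstarAlgType R) (f : {linear A -> A}).
Hypotheses (f_cp : completely_positive f) (f_cc : completely_contractive f).

Definition cesaro x n : A :=
  (n.+1%:R^-1)%:C *: \sum_(k < n.+1) iter k f x.

Lemma iterP k (c : R[i]) x y :
  iter k f (c *: x + y) = c *: iter k f x + iter k f y.
Proof. by elim: k => //= k ->; rewrite linearP. Qed.

Lemma cesaroP n (c : R[i]) x y :
  cesaro (c *: x + y) n = c *: cesaro x n + cesaro y n.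
Proof.
rewrite /cesaro scalerA mulrC -scalerA -scalerDr; congr (_ *: _).
by rewrite scaler_sumr -big_split /=; apply: eq_bigr => k _; exact: iterP.
Qed.

Lemma rnorm_iter k x : rnorm (iter k f x) <= rnorm x.
Proof. by elim: k => //= k IH; apply: le_trans (cc_rnorm _ f_cc) IH. Qed.

Lemma mean_le n (F : 'I_n.+1 -> A) c : (forall k, rnorm (F k) <= c) ->
  rnorm ((n.+1%:R^-1)%:C *: \sum_k F k) <= c.
Proof.
move=> Fc; rewrite rnormZR ger0_norm ?invr_ge0 // ler_pdivrMl ?ltr0n //.
rewrite (le_trans (rnorm_sum _ _ _)) // (le_trans (ler_sum _ (fun k _ => Fc k))) //.
by rewrite sumr_const card_ord mulr_natl.
Qed.

Lemma rbounded_cesaro x : rbounded (cesaro x).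
Proof. by exists (rnorm x) => n; apply: mean_le => k; exact: rnorm_iter. Qed.

Lemma cesaro_fixed x n : f x = x -> cesaro x n = x.
Proof.
move=> fx; have ix k : iter k f x = x by elim: k => //= k ->.
rewrite /cesaro (eq_bigr (fun=> x)) => [|k _]; last exact: ix.
rewrite sumr_const card_ord.
have -> : x *+ n.+1 = (n.+1%:R : R)%:C *: x by rewrite rmorph_nat scaler_nat.
by rewrite scalerA -rmorphM /= mulVf ?pnatr_eq0 // scale1r.
Qed.

(** The sum telescopes to (f^(n+1) x - x) / (n+1), of norm at most 2 |x| / (n+1). *)
Lemma cesaro_shift x : rcvg (fun n => f (cesaro x n) - cesaro x n) 0.
Proof.
apply: (@rcvg_sqrt _ _ _ ((2 * rnorm x) ^+ 2)) => n.
have -> : f (cesaro x n) - cesaro x n = (n.+1%:R^-1)%:C *: (iter n.+1 f x - x).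
  rewrite /cesaro linearZ -scalerBr linear_sum -sumrB; congr (_ *: _).
  elim: n.+1 => [|m IH]; first by rewrite big_ord0 subrr.
  by rewrite big_ord_recr IH /= [LHS]addrC subrKA.
rewrite rnormZR ger0_norm ?invr_ge0 // exprMn.
have h : rnorm (iter n.+1 f x - x) <= 2 * rnorm x.
  by have := rnormB (iter n.+1 f x) x; have := rnorm_iter n.+1 x; lra.
have {}h : rnorm (iter n.+1 f x - x) ^+ 2 <= (2 * rnorm x) ^+ 2.
  by rewrite ler_sqr ?nnegrE ?mulr_ge0 ?rnorm_ge0.
apply: le_trans h; rewrite mulrA ler_piMl ?sqr_ge0 // exprVn ler_pdivrMr ?exprn_gt0 //.
by rewrite mul1r -natrX ler_nat; nia.
Qed.

Lemma dot_cesaro m (X : 'M[A]_m) (v w : 'cV[A]_m) n :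
  dot w (map_mx (cesaro ^~ n) X *m v) =
  (n.+1%:R^-1)%:C *: \sum_(k < n.+1) dot w (map_mx (iter k f) X *m v).
Proof.
rewrite /dot exchange_big scaler_sumr; apply: eq_bigr => i _.
rewrite -mulr_sumr -scaleAr; congr (_ * _); rewrite mxE.
under [in RHS]eq_bigr do rewrite mxE.
rewrite exchange_big scaler_sumr; apply: eq_bigr => j _.
by rewrite mxE scaleAl mulr_suml; congr (_ *: _); apply: eq_bigr => k _; rewrite mxE.
Qed.

Lemma cp_iter k : completely_positive (iter k f).
Proof.
elim: k => [|k IH] n X pX; first by rewrite map_mx_id.
have -> : map_mx (iter k.+1 f) X = map_mx f (map_mx (iter k f) X).
  by apply/matrixP => i j; rewrite !mxE.
exact/f_cp/IH.
Qed.

Lemma cc_iter k : completely_contractive (iter k f).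
Proof.
elim: k => [|k IH] n X; first by rewrite map_mx_id.
have -> : map_mx (iter k.+1 f) X = map_mx f (map_mx (iter k f) X).
  by apply/matrixP => i j; rewrite !mxE.
exact: le_trans (f_cc _) (IH _ _).
Qed.

Section Limit.
Variables (D : predual A) (U : set_system nat).
Hypotheses (U_ultra : UltraFilter U) (U_free : \oo `<=` U).
Variable P : A -> A.
Hypothesis cesaro_cvg : forall x, wcvg D U (cesaro x) (P x).

Lemma wcvg_dot_cesaro m (X : 'M[A]_m) (v w : 'cV[A]_m) :
  wcvg D U (fun n => dot w (map_mx (cesaro ^~ n) X *m v)) (dot w (map_mx P X *m v)).
Proof.
apply: (wcvg_sum U_ultra) => i.
have bd j : rbounded (fun n => cesaro (X i j) n * v j 0).
  have [K h] := rbounded_cesaro (X i j); exists (K * rnorm (v j 0)) => n.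
  by rewrite (le_trans (rnormM _ _)) // ler_wpM2r ?rnorm_ge0.
have E (g : A -> A) : (map_mx g X *m v) i 0 = \sum_j g (X i j) * v j 0.
  by rewrite mxE; apply: eq_bigr => j _; rewrite mxE.
rewrite E; under eq_fun do rewrite E.
apply: (wcvg_mull U_ultra); first exact: rbounded_sum.
apply: (wcvg_sum U_ultra) => j.
exact: (wcvg_mulr U_ultra (b := v j 0) (rbounded_cesaro _) (@cesaro_cvg (X i j))).
Qed.

Lemma cesaro_lim_cp : completely_positive P.
Proof.
move=> m X pX; apply: (psd_mx_ge0 D U_ultra U_free) => v.
apply: (wcvg_psq U_ultra _ _ (@wcvg_dot_cesaro m X v v)) => [n|].
  rewrite dot_cesaro; apply: psqZ; first by rewrite invr_ge0.
  by apply: psq_sum => k _; apply: mx_ge0_psq; exact: cp_iter.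
exists (hilb_norm v * (cstar_mxnorm X * hilb_norm v)) => n.
rewrite dot_cesaro; apply: mean_le => k; apply: le_trans (rnorm_dot_mx_le _ _ _) _.
by rewrite ler_wpM2l ?hilb_norm_ge0 // ler_wpM2r ?hilb_norm_ge0 // cc_iter.
Qed.

(** The weak* limit controls inner products, not [hilb_norm] directly; testing against y = P(X) v
    itself gives |y|^2 <= |y| |X|, and |y| is divided out. *)
Lemma cesaro_lim_cc : completely_contractive P.
Proof.
move=> m X; apply: cstar_mxnorm_le => v v1; set y := _ *m v.
have := hilb_norm_ge0 y; rewrite le_eqVlt => /predU1P[<-|y0].
  exact: cstar_mxnorm_ge0.
rewrite -(ler_pM2l y0) -expr2 sqr_hilb_norm.
apply: (wcvg_le U_ultra (@wcvg_dot_cesaro m X v y)) => n.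
rewrite dot_cesaro; apply: mean_le => k; apply: le_trans (rnorm_dot_mx_le _ _ _) _.
rewrite ler_wpM2l ?hilb_norm_ge0 // -[leRHS]mulr1.
by rewrite ler_pM ?cstar_mxnorm_ge0 ?hilb_norm_ge0 // cc_iter.
Qed.

Lemma cesaro_lim_linear : linear P.
Proof.
move=> c x y; apply: (wcvg_unique U_ultra (@cesaro_cvg _)).
rewrite (_ : cesaro _ = fun n => c *: cesaro x n + cesaro y n); last first.
  by apply/funext => n; exact: cesaroP.
exact: (wcvgD U_ultra (wcvgZ U_ultra (@cesaro_cvg x)) (@cesaro_cvg y)).
Qed.

Lemma cesaro_lim_id x : f x = x -> P x = x.
Proof.
move=> fx; apply: (wcvg_unique U_ultra (@cesaro_cvg x)).
rewrite (_ : cesaro x = fun=> x); last by apply/funext => n; exact: cesaro_fixed.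
exact: wcvg_cst.
Qed.

Lemma cesaro_lim_fixed x : weakstar_continuous D f -> f (P x) = P x.
Proof.
move=> f_cont; apply: (wcvg_unique U_ultra (wcvg_map U_ultra f_cont (@cesaro_cvg x))).
have := wcvgD U_ultra (wcvg_null U_ultra U_free (cesaro_shift x)) (@cesaro_cvg x).
rewrite add0r (_ : (fun n => _) = f \o cesaro x) //.
by apply/funext => n; rewrite subrK.
Qed.

End Limit.
End CesaroMeans.

Theorem corollary3p8 (R : realType) (M : cstarAlgType R) (D : predual M)
    (alpha : {linear M -> M}) :
  weakstar_continuous D alpha ->
  completely_positive alpha ->
  completely_contractive alpha ->
  exists P : {linear M -> M},
    [/\ (forall x, P (P x) = P x),
        completely_positive P,
        completely_contractive P &
        range P = fixed_points alpha].
Proof.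
move=> f_cont f_cp f_cc.
have [U [U_ultra U_free]] := ultraFilterLemma (eventually_filter : ProperFilter \oo).
have lim_ex x : exists a, wcvg D U (cesaro alpha x) a.
  exact: (rbounded_ex D U_ultra (rbounded_cesaro f_cc x)).
pose P x := projT1 (cid (lim_ex x)).
have P_cvg x : wcvg D U (cesaro alpha x) (P x) := projT2 (cid (lim_ex x)).
have P_lin : linear P by exact: (cesaro_lim_linear U_ultra P_cvg).
have P_fixed x : alpha (P x) = P x.
  exact: (cesaro_lim_fixed f_cc U_ultra U_free P_cvg x f_cont).
have P_id x : alpha x = x -> P x = x by exact: (cesaro_lim_id U_ultra P_cvg).
pose Q : {linear M -> M} := HB.pack P (GRing.isLinear.Build _ _ _ _ _ P_lin).
exists Q; split.
- by move=> x; exact: P_id.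
- exact: (cesaro_lim_cp f_cp f_cc U_ultra U_free P_cvg).
- exact: (cesaro_lim_cc f_cc U_ultra P_cvg).
- by apply/seteqP; split=> [_ [x _ <-]|x /P_id Px]; [exact: P_fixed | exists x].
Qed.
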